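(* Consider the target/source factor model, Assumptions (A1)–(A6), and the oracle TransPCA estimators described in the context, with $s$ and $r_k$, $k\in\{0\}\cup\mathcal A$, fixed and known and $\mathbf D_w$ known. Assume further $\varepsilon=o\big(1/\sqrt{N^{1-\alpha_s}}\big)$. Let $$\delta=\frac{\sqrt{N^{\alpha_1}}}{\sqrt N}\Big(\frac{\sqrt{T_0}N}{TN^{\alpha_s}}+\frac{T_0}{TN^{\alpha_s}}+\frac1{\sqrt T}+\frac1N+\varepsilon\Big).$$ Then, as $N\to\infty$ and $\min_{k\in\{0\}\cup\mathcal A}T_k\to\infty$, there is an invertible $(r_0-s)\times(r_0-s)$ matrix $\mathbf H_s$ with $$\frac1{\sqrt N}\big\|\hat{\boldsymbol\Lambda}^{(0)}_s-\boldsymbol\Lambda^{(0)}_s\mathbf H_s\big\|=O_p\Big(\frac{\sqrt N}{\sqrt{N^{\alpha_s}}}\delta+\frac1{\sqrt{T_0}}+\frac{\sqrt{N^{\alpha_1}}}{\sqrt{N^{1+\alpha_s}}}\Big),$$ $$\frac1{\sqrt {T_0}}\big\|\hat{\mathbf F}^{(0)}_s-\mathbf F^{(0)}_s(\mathbf H_s^{\top})^{-1}\big\|=O_p\Big(\frac{\sqrt N}{\sqrt{N^{\alpha_s}}}\delta+\frac1{\sqrt{T_0}}+\frac{\sqrt{N^{\alpha_1}}}{\sqrt{N^{1+\alpha_s}}}\Big).$$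
   Context: Model. $N$ is the cross-sectional dimension. Target $\mathbf X^{(0)}=\mathbf F^{(0)}\boldsymbol\Lambda^{(0)\top}+\mathbf E^{(0)}\in\mathbb R^{T_0\times N}$ with $\mathbf F^{(0)}=(\mathbf f^{(0)}_1,\dots,\mathbf f^{(0)}_{T_0})^\top\in\mathbb R^{T_0\times r_0}$, $\boldsymbol\Lambda^{(0)}\in\mathbb R^{N\times r_0}$, errors with entries $\epsilon^{(0)}_{ti}$. Sources $\mathbf X^{(k)}=\mathbf F^{(k)}\boldsymbol\Lambda^{(k)\top}+\mathbf E^{(k)}\in\mathbb R^{T_k\times N}$, $k\in[K]$, with $r_k$ factors. $\mathcal A\subseteq[K]$ known informative set, $T=\sum_{k\in\{0\}\cup\mathcal A}T_k$. $\boldsymbol\Lambda^{(0)}=(\boldsymbol\Lambda^{(0)}_s,\boldsymbol\Lambda^{(0)}_w)$, $\boldsymbol\Lambda^{(0)}_s\in\mathbb R^{N\times(r_0-s)}$ strong, $\boldsymbol\Lambda^{(0)}_w\in\mathbb R^{N\times s}$ weak, $\mathbf F^{(0)}=(\mathbf F^{(0)}_s,\mathbf F^{(0)}_w)$ correspondingly. For $k\in\mathcal A$, columns of $\boldsymbol\Lambda^{(k)}$ split into $\boldsymbol\Lambda^{(k)}_{\mathcal T}\in\mathbb R^{N\times s}$ and $\boldsymbol\Lambda^{(k)}_{\mathcal T^c}$ with $\mathbf P_{\boldsymbol\Lambda^{(k)}}=\mathbf P_{\boldsymbol\Lambda^{(k)}_{\mathcal T}}+\mathbf P_{\boldsymbol\Lambda^{(k)}_{\mathcal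 T^c}}$, and $\mathbf P_{\boldsymbol\Lambda^{(0)}}=\mathbf P_{\boldsymbol\Lambda^{(0)}_w}+\mathbf P_{\boldsymbol\Lambda^{(0)}_s}$; $\mathbf P_{\mathbf A}=\mathbf A(\mathbf A^\top\mathbf A)^{-1}\mathbf A^\top$. $\|\cdot\|$ spectral, $\|\cdot\|_F$ Frobenius, $\|\cdot\|_{\max}$ max entry, $M$ finite constant. Assumptions. (A1) For all $k\in\{0\}\cup[K]$: $E\|\mathbf f^{(k)}_t\|^4\le M$; $\mathbf F^{(k)\top}\mathbf F^{(k)}/T_k\to\boldsymbol\Sigma^{(k)}_F$ in probability, positive definite with bounded distinct eigenvalues. (A2) $\|\boldsymbol\Lambda^{(k)}\|_{\max}\le M$; $\|\mathbf D^{-1/2}\boldsymbol\Lambda^{(0)\top}\boldsymbol\Lambda^{(0)}\mathbf D^{-1/2}-\mathbf I_{r_0}\|\to0$ with $\mathbf D=\mathrm{diag}(\mathbf D_s,\mathbf D_w)$, $(\mathbf D_s)_{ii}\asymp N$, $(\mathbf D_w)_{ii}\asymp N^{\alpha_i}$, $0<\alpha_s\le\dots\le\alpha_1<1$; $\|N^{-1}\boldsymbol\Lambda^{(k)\top}\boldsymbol\Lambda^{(k)}-\mathbf I_{r_k}\|\to0$, $k\in[K]$. (A3) $\|\mathbf E^{(k)}\|^2=O_p(N\vee T_k)$. (A4) For each $t$: $E\|\mathbf D^{-1/2}\sum_i\boldsymbol\Lambda^{(0)\top}_{i,\cdot}\epsilon^{(0)}_{ti}\|^2\le M$, $E\|N^{-1/2}\sum_i\boldsymbol\Lambda^{(k)\top}_{i,\cdot}\epsilon^{(k)}_{ti}\|^2\le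 M$ ($k\in[K]$); for each $i$: $E\|T_k^{-1/2}\sum_t\mathbf f^{(k)}_t\epsilon^{(k)}_{ti}\|^2\le M$. (A5) $\|\mathbf P_{\boldsymbol\Lambda^{(k)}_{\mathcal T}}-\mathbf P_{\boldsymbol\Lambda^{(0)}_w}\|_F\le\varepsilon$ for $k\in\mathcal A$; for a constant $\kappa>0$, $T^{-1}\|T_0\mathbf P_{\boldsymbol\Lambda^{(0)}_s}+\sum_{k\in\mathcal A}T_k\mathbf P_{\boldsymbol\Lambda^{(k)}_{\mathcal T^c}}\|\le1-\kappa$. (A6) (1) $N/(\sqrt{T_0}N^{\alpha_s})\to0$; (2) $T_0\sqrt N/(T\sqrt{N^{\alpha_s}})\to0$. Oracle TransPCA. $\hat{\mathbf Q}^{(k)}$: leading $r_k$ orthonormal eigenvectors of $\mathbf X^{(k)\top}\mathbf X^{(k)}/(NT_k)$; $\hat{\mathbf Q}^{(0)}_w$: leading $s$ eigenvectors of $T^{-1}\sum_{k\in\{0\}\cup\mathcal A}T_k\hat{\mathbf Q}^{(k)}\hat{\mathbf Q}^{(k)\top}$; $\hat{\boldsymbol\Lambda}^{(0)}_w=\hat{\mathbf Q}^{(0)}_w\mathbf D_w^{1/2}$, $\hat{\mathbf F}^{(0)}_w=\mathbf X^{(0)}\hat{\boldsymbol\Lambda}^{(0)}_w\mathbf D_w^{-1}$; $\hat{\mathbf Q}^{(0)}_s$: leading $r_0-s$ eigenvectors of $(\mathbf I_N-\hat{\mathbf Q}^{(0)}_w\hat{\mathbf Q}^{(0)\top}_w)\tfrac1{T_0}\mathbf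 X^{(0)\top}\mathbf X^{(0)}(\mathbf I_N-\hat{\mathbf Q}^{(0)}_w\hat{\mathbf Q}^{(0)\top}_w)$; $\hat{\boldsymbol\Lambda}^{(0)}_s=\sqrt N\hat{\mathbf Q}^{(0)}_s$; $\hat{\mathbf F}^{(0)}_s=N^{-1}(\mathbf X^{(0)}-\hat{\mathbf F}^{(0)}_w\hat{\boldsymbol\Lambda}^{(0)\top}_w)\hat{\boldsymbol\Lambda}^{(0)}_s$. *)

(* Defs.v *)
From HB Require Import structures.
From mathcomp Require Import all_boot all_order all_algebra.
From mathcomp Require Import all_classical all_reals all_analysis.
Set Implicit Arguments. Unset Strict Implicit. Unset Printing Implicit Defensive.
Import Order.TTheory GRing.Theory Num.Theory.
Local Open Scope classical_set_scope.
Local Open Scope ring_scope.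

Section LinAlg.
Variable R : realType.

Definition vnorm {n} (x : 'cV[R]_n) : R := Num.sqrt (\sum_i x i 0 ^+ 2).
Definition rvnorm {n} (x : 'rV[R]_n) : R := Num.sqrt (\sum_j x 0 j ^+ 2).

Definition specn {m n} (A : 'M[R]_(m, n)) : R :=
  sup [set vnorm (A *m x) | x in [set x : 'cV[R]_n | vnorm x <= 1]].
Definition frobn {m n} (A : 'M[R]_(m, n)) : R :=
  Num.sqrt (\sum_i \sum_j A i j ^+ 2).
Definition maxnorm {m n} (A : 'M[R]_(m, n)) : R :=
  \big[Num.max/0]_i \big[Num.max/0]_j `|A i j|.

Definition projm {N r} (A : 'M[R]_(N, r)) : 'M[R]_N :=
  A *m invmx (A^T *m A) *m A^T.

Definition colsel {N r} (A : 'M[R]_(N, r)) (S : {set 'I_r}) : 'M[R]_(N, #|S|) :=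
  colsub (fun j : 'I_#|S| => enum_val j) A.

Definition diagv {n} (v : 'I_n -> R) : 'M[R]_n := diag_mx (\row_i v i).

(* Q consists of the r leading orthonormal eigenvectors of the symmetric
   matrix S: the columns of Q are the first r columns of an orthonormal
   eigenbasis U of S whose eigenvalues are listed in nonincreasing order.
   (Only required when r <= N, the only case where it makes sense.) *)
Definition leading_eigvecs {N r} (S : 'M[R]_N) (Q : 'M[R]_(N, r)) : Prop :=
  (r <= N)%N ->
  exists (U : 'M[R]_N) (lam : 'I_N -> R),
    [/\ U^T *m U = 1%:M,
        S = U *m diagv lam *m U^T,
        (forall i j : 'I_N, (i <= j)%N -> lam j <= lam i) &
        (forall (i : 'I_N) (j : 'I_r), (i : nat) = j -> col j Q = col i U)].

Definition pd_distinct_eig {r} (S : 'M[R]_r) : Prop :=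
  exists (U : 'M[R]_r) (lam : 'I_r -> R),
    [/\ U^T *m U = 1%:M,
        S = U *m diagv lam *m U^T,
        (forall i, 0 < lam i) &
        (forall i j, i != j -> lam i != lam j)].

Definition tends0 (u : nat -> R) : Prop :=
  forall e, 0 < e -> exists n0, forall n, (n0 <= n)%N -> `|u n| < e.

Definition nat_to_infty (u : nat -> nat) : Prop :=
  forall B, exists n0, forall n, (n0 <= n)%N -> (B <= u n)%N.

Definition Lw_hat {N s} (Qw : 'M[R]_(N, s)) (dw : 'I_s -> R) : 'M[R]_(N, s) :=
  Qw *m diagv (fun i => Num.sqrt (dw i)).
Definition Fw_hat {T N s} (X0 : 'M[R]_(T, N)) (Qw : 'M[R]_(N, s))
  (dw : 'I_s -> R) : 'M[R]_(T, s) :=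
  X0 *m Lw_hat Qw dw *m diagv (fun i => (dw i)^-1).
(* matrix whose leading eigenvectors give Q_s hat *)
Definition strong_mat {T N s} (X0 : 'M[R]_(T, N)) (Qw : 'M[R]_(N, s)) : 'M[R]_N :=
  (1%:M - Qw *m Qw^T) *m ((T%:R)^-1 *: (X0^T *m X0)) *m (1%:M - Qw *m Qw^T).
Definition Ls_hat {N q} (Qs : 'M[R]_(N, q)) : 'M[R]_(N, q) :=
  Num.sqrt (N%:R) *: Qs.
Definition Fs_hat {T N s q} (X0 : 'M[R]_(T, N)) (Qw : 'M[R]_(N, s))
  (dw : 'I_s -> R) (Qs : 'M[R]_(N, q)) : 'M[R]_(T, q) :=
  (N%:R)^-1 *: ((X0 - Fw_hat X0 Qw dw *m (Lw_hat Qw dw)^T) *m Ls_hat Qs).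

End LinAlg.

Section Prob.
Variables (d : measure_display) (Omega : measurableType d) (R : realType).
Variable (P : probability Omega R).

Definition outer_le (A : set Omega) (e : R) : Prop :=
  exists B, [/\ measurable B, A `<=` B & (P B <= e%:E)%E].

(* X_n = O_p(b_n) for nonnegative X_n *)
Definition Op (X : nat -> Omega -> R) (b : nat -> R) : Prop :=
  forall e, 0 < e -> exists C, 0 < C /\ exists n0, forall n, (n0 <= n)%N ->
    outer_le [set w | C * b n < X n w] e.

(* X_n -> 0 in probability, X_n nonnegative *)
Definition cvg_prob0 (X : nat -> Omega -> R) : Prop :=
  forall e del, 0 < e -> 0 < del -> exists n0, forall n, (n0 <= n)%N ->
    outer_le [set w | e < X n w] del.

Definition Enn (X : Omega -> R) : \bar R := (\int[P]_w (X w)%:E)%E.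

Definition rmx_meas {m n} (X : Omega -> 'M[R]_(m, n)) : Prop :=
  forall i j, measurable_fun setT (fun w => X w i j).

End Prob.

Definition delta_rate (R : realType) (N T0 T : nat) (a1 as_ eps : R) : R :=
  Num.sqrt ((N%:R) `^ a1) / Num.sqrt (N%:R) *
  (Num.sqrt (T0%:R) * N%:R / (T%:R * (N%:R `^ as_))
   + T0%:R / (T%:R * (N%:R `^ as_))
   + (Num.sqrt (T%:R))^-1 + (N%:R)^-1 + eps).

Definition thm2_rate (R : realType) (N T0 T : nat) (a1 as_ eps : R) : R :=
  Num.sqrt (N%:R) / Num.sqrt ((N%:R) `^ as_) * delta_rate N T0 T a1 as_ eps
  + (Num.sqrt (T0%:R))^-1
  + Num.sqrt ((N%:R) `^ a1) / Num.sqrt ((N%:R) `^ (1 + as_)).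

Definition Ebound (d : measure_display) (Omega : measurableType d) (R : realType)
  (P : probability Omega R) (X : Omega -> R) (M : R) : Prop :=
  (Enn P X <= M%:E)%E.

(* Main.v *)
Require Import Defs.
From HB Require Import structures.
From mathcomp Require Import all_boot all_order all_algebra.
From mathcomp Require Import all_classical all_reals all_analysis.
From mathcomp Require Import measurable_realfun ring lra.
Set Implicit Arguments. Unset Strict Implicit. Unset Printing Implicit Defensive.
Import Order.TTheory GRing.Theory Num.Theory.
Local Open Scope classical_set_scope.
Local Open Scope ring_scope.

(* All subspace errors are controlled by one inequality: if V spans the top
   eigenspace of S and x^T S x >= mu |x|^2 on a space of the same dimension,
   then mu ||(I-P) V||_F <= ||(I-P) S V||_F.
   Applied to X^T X this gives the error of each PCA projector; averaging these
   errors and applying it again to P_w + B + (small), where ||B|| <= 1 - kappa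
   and B P_w = O(eps), gives rho = ||(I-P_w) Qw||_F = O_p(g), where g is the
   bracket in the definition of delta.  A third application, to the deflated
   covariance of the target, gives
   tau = ||(I-P_s) Qs||_F = O_p(rho + T_0^{-1/2} + N^{-1}).
   With H = sqrt N (Ls^T Ls)^{-1} Ls^T Qs one has Ls H = sqrt N P_s Qs, so the
   loading error is exactly tau, and the factor error is
   O_p(rho + tau + T_0^{-1/2} + N^{-1/2}).
   As alpha_1 >= alpha_s, the stated rate dominates g + T_0^{-1/2} + N^{-1/2},
   so that these crude bounds suffice. *)

(** * Frobenius and spectral norms *)

(** All ranks are fixed, so Frobenius norms lose only constants against spectral ones, and they turn
    comparisons of subspaces into trace identities. The spectral norm is essential for the errors
    and for the gap matrix [B], whose Frobenius norms would be too large. Eigenbases are determined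
    only up to rotation, hence every error is measured through the complement of a projector. The
    basic inequality needs only a lower bound on the form of [S] over a trial space, so no
    separation between empirical eigenvalues has to be proved. Randomness is confined to one event
    per sample, [regular_sample]; on it every bound is deterministic, with a single constant [C]. *)

Section Frobenius.
Variable R : realType.
Implicit Types m n p q : nat.

(** An operator norm bound phrased as an inequality, for right factors of every width, so that such
    bounds chain inside products without handling the supremum in [specn]. *)
Definition opb {m n} (A : 'M[R]_(m, n)) (a : R) : Prop :=
  forall p (B : 'M[R]_(n, p)), frobn (A *m B) <= a * frobn B.

Lemma frobn_ge0 m n (A : 'M[R]_(m, n)) : 0 <= frobn A.
Proof. exact: sqrtr_ge0. Qed.
Hint Resolve frobn_ge0 : core.

Lemma sum_sqr_ge0 m n (A : 'M[R]_(m, n)) : 0 <= \sum_i \sum_j A i j ^+ 2.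
Proof. by apply: sumr_ge0 => i _; apply: sumr_ge0 => j _; exact: sqr_ge0. Qed.

Lemma frobn_sqr m n (A : 'M[R]_(m, n)) : frobn A ^+ 2 = \sum_i \sum_j A i j ^+ 2.
Proof. by rewrite sqr_sqrtr // sum_sqr_ge0. Qed.

Lemma dotE m n (A B : 'M[R]_(m, n)) :
  \tr (A^T *m B) = \sum_i \sum_j A i j * B i j.
Proof.
rewrite /mxtrace exchange_big /=; apply: eq_bigr => i _.
by rewrite mxE; apply: eq_bigr => j _; rewrite mxE.
Qed.

Lemma frobn_sqr_tr m n (A : 'M[R]_(m, n)) : frobn A ^+ 2 = \tr (A^T *m A).
Proof.
by rewrite frobn_sqr dotE; apply: eq_bigr => i _; apply: eq_bigr => j _; rewrite expr2.
Qed.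

Lemma dotC m n (A B : 'M[R]_(m, n)) : \tr (A^T *m B) = \tr (B^T *m A).
Proof. by rewrite -mxtrace_tr trmx_mul trmxK. Qed.

Lemma frobn_eq0 m n (A : 'M[R]_(m, n)) : frobn A = 0 -> A = 0.
Proof.
move=> h; apply/matrixP => i j; rewrite mxE.
have /eqP : \sum_i \sum_j A i j ^+ 2 = 0 by rewrite -frobn_sqr h expr0n.
rewrite psumr_eq0 => [/allP/(_ i (mem_index_enum _))/= /eqP/eqP|k _]; last first.
  by apply: sumr_ge0 => ? _; exact: sqr_ge0.
rewrite psumr_eq0 => [/allP/(_ j (mem_index_enum _))/=|k _]; last exact: sqr_ge0.
by rewrite sqrf_eq0 => /eqP.
Qed.

Lemma frobn0 m n : frobn (0 : 'M[R]_(m, n)) = 0.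
Proof.
by rewrite /frobn big1 ?sqrtr0 // => i _; rewrite big1 // => j _; rewrite mxE expr0n.
Qed.

Lemma frobnZ m n a (A : 'M[R]_(m, n)) : frobn (a *: A) = `|a| * frobn A.
Proof.
apply/eqP; rewrite -(@eqrXn2 _ 2) ?mulr_ge0 // exprMn !frobn_sqr real_normK ?num_real //.
rewrite mulr_sumr; apply/eqP; apply: eq_bigr => i _; rewrite mulr_sumr.
by apply: eq_bigr => j _; rewrite mxE exprMn.
Qed.

Lemma frobnN m n (A : 'M[R]_(m, n)) : frobn (- A) = frobn A.
Proof. by rewrite -scaleN1r frobnZ normrN1 mul1r. Qed.

Lemma frobn_trmx m n (A : 'M[R]_(m, n)) : frobn A^T = frobn A.
Proof.
rewrite /frobn exchange_big /=; congr Num.sqrt.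
by apply: eq_bigr => i _; apply: eq_bigr => j _; rewrite mxE.
Qed.

Lemma frobnD_sqr m n (A B : 'M[R]_(m, n)) :
  frobn (A + B) ^+ 2 = frobn A ^+ 2 + 2 * \tr (A^T *m B) + frobn B ^+ 2.
Proof.
have eT : (A + B)^T = A^T + B^T by rewrite linearD.
rewrite !frobn_sqr_tr eT mulmxDl !mulmxDr !mxtraceD (dotC B A).
by rewrite mulr_natl mulr2n !addrA.
Qed.

Lemma dot_le m n (A B : 'M[R]_(m, n)) : \tr (A^T *m B) <= frobn A * frobn B.
Proof.
have [a0|a0] := eqVneq (frobn A) 0.
  by rewrite a0 mul0r (frobn_eq0 a0) trmx0 mul0mx mxtrace0.
have [b0|b0] := eqVneq (frobn B) 0.
  by rewrite b0 mulr0 (frobn_eq0 b0) mulmx0 mxtrace0.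
have ab : 0 < frobn A * frobn B by rewrite mulr_gt0 // lt_def ?a0 ?b0 /=.
set a := frobn A in ab *; set b := frobn B in ab *.
have := sqr_ge0 (frobn (b *: A + (- a) *: B)).
have eT : (b *: A)^T = b *: A^T by rewrite linearZ.
rewrite frobnD_sqr !frobnZ eT -scalemxAl -scalemxAr !mxtraceZ normrN -/a -/b.
have [a1 b1] : 0 <= a /\ 0 <= b by rewrite /a /b.
rewrite !ger0_norm // => h.
rewrite -(ler_pM2l ab); lra.
Qed.

Lemma frobnD m n (A B : 'M[R]_(m, n)) : frobn (A + B) <= frobn A + frobn B.
Proof.
rewrite -(@ler_pXn2r _ 2) ?nnegrE ?addr_ge0 //.
by rewrite frobnD_sqr sqrrD; have := dot_le A B; lra.
Qed.

Lemma frobn_sum (I : Type) (s : seq I) (Q : pred I) m n (F : I -> 'M[R]_(m, n)) :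
  frobn (\sum_(i <- s | Q i) F i) <= \sum_(i <- s | Q i) frobn (F i).
Proof.
apply: (big_ind2 (fun (A : 'M[R]_(m,n)) x => frobn A <= x)) => //.
- by rewrite frobn0.
- by move=> A x B y hA hB; rewrite (le_trans (frobnD _ _)) // lerD.
Qed.

(** A rearrangement of [0 <= frobn (2^-1 *: A + B) ^+ 2]. With [A] as signal and [B] as noise, it
    removes the cross term at the price of half the signal. *)
Lemma frobnD_sqr_ge m n (A B : 'M[R]_(m, n)) :
  2^-1 * frobn A ^+ 2 - frobn B ^+ 2 <= frobn (A + B) ^+ 2.
Proof.
have eT : (2^-1 *: A)^T = 2^-1 *: A^T by rewrite linearZ.
have := sqr_ge0 (frobn (2^-1 *: A + B)); have hA := sqr_ge0 (frobn A).
have := frobnD_sqr A B.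
rewrite !(frobnD_sqr (2^-1 *: A)) !frobnZ eT -!scalemxAl !mxtraceZ.
rewrite !exprMn !real_normK ?num_real // => h1 h2; lra.
Qed.

Lemma frobn_sqr_col m n (A : 'M[R]_(m, n)) :
  frobn A ^+ 2 = \sum_j frobn (col j A) ^+ 2.
Proof.
rewrite frobn_sqr exchange_big /=; apply: eq_bigr => j _.
by rewrite frobn_sqr; apply: eq_bigr => i _; rewrite big_ord1 mxE.
Qed.

(** Squared Frobenius norms add over columns, so testing on vectors suffices. *)
Lemma opb_col m n (A : 'M[R]_(m, n)) a : 0 <= a ->
  (forall x : 'cV[R]_n, frobn (A *m x) <= a * frobn x) -> opb A a.
Proof.
move=> a0 h p B; rewrite -(@ler_pXn2r _ 2) ?nnegrE ?mulr_ge0 //.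
rewrite exprMn !frobn_sqr_col mulr_sumr; apply: ler_sum => j _.
by rewrite colE -mulmxA -colE -exprMn ler_pXn2r ?nnegrE ?mulr_ge0.
Qed.

Lemma vnormE n (x : 'cV[R]_n) : vnorm x = frobn x.
Proof.
by rewrite /vnorm /frobn; congr Num.sqrt; apply: eq_bigr => i _; rewrite big_ord1.
Qed.

Lemma frobn_row_mulmx m n (A : 'M[R]_(m, n)) (x : 'cV[R]_n) i :
  (A *m x) i 0 ^+ 2 <= (\sum_j A i j ^+ 2) * frobn x ^+ 2.
Proof.
have e : (A *m x) i 0 = \tr ((row i A)^T^T *m x).
  by rewrite trmxK /mxtrace big_ord1 !mxE; apply: eq_bigr => j _; rewrite mxE.
have er : frobn (row i A)^T ^+ 2 = \sum_j A i j ^+ 2.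
  by rewrite frobn_trmx frobn_sqr big_ord1; apply: eq_bigr => j _; rewrite mxE.
rewrite -er -exprMn e -[X in X <= _]real_normK ?num_real // ler_pXn2r ?nnegrE ?mulr_ge0//.
rewrite ler_norml dot_le andbT lerNl.
by have := dot_le (- (row i A)^T) x; rewrite frobnN !linearN /= mulNmx linearN.
Qed.

Lemma opb_frobn m n (A : 'M[R]_(m, n)) : opb A (frobn A).
Proof.
apply: opb_col => // x; rewrite -(@ler_pXn2r _ 2) ?nnegrE ?mulr_ge0 //.
rewrite exprMn frobn_sqr (frobn_sqr A) mulr_suml; apply: ler_sum => i _.
by rewrite big_ord1 frobn_row_mulmx.
Qed.

Lemma frobnM m n p (A : 'M[R]_(m, n)) (B : 'M[R]_(n, p)) :
  frobn (A *m B) <= frobn A * frobn B.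
Proof. exact: opb_frobn. Qed.

Lemma opb_le m n (A : 'M[R]_(m, n)) a b : a <= b -> opb A a -> opb A b.
Proof. by move=> ab hA p B; rewrite (le_trans (hA _ _)) // ler_wpM2r. Qed.

(** [||A^T B||^2 = <B, A A^T B> <= ||B|| a ||A^T B||], and one factor [||A^T B||] cancels. *)
Lemma opb_trmx m n (A : 'M[R]_(m, n)) a : 0 <= a -> opb A a -> opb A^T a.
Proof.
move=> a0 hA p B.
have [z|nz] := eqVneq (frobn (A^T *m B)) 0; first by rewrite z mulr_ge0.
have pz : 0 < frobn (A^T *m B) by rewrite lt_def nz /=.
rewrite -(ler_pM2l pz) -expr2 frobn_sqr_tr trmx_mul trmxK -mulmxA.
rewrite (le_trans (dot_le _ _)) //.
by have := ler_wpM2l (frobn_ge0 B) (hA _ (A^T *m B)); lra.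
Qed.

Lemma frobnM_opbr m n p (A : 'M[R]_(m, n)) (B : 'M[R]_(n, p)) b :
  0 <= b -> opb B b -> frobn (A *m B) <= frobn A * b.
Proof.
move=> b0 hB; rewrite -frobn_trmx trmx_mul mulrC -(frobn_trmx A).
exact: opb_trmx.
Qed.

Lemma frobn_orth m n p (V : 'M[R]_(m, n)) (B : 'M[R]_(n, p)) :
  V^T *m V = 1%:M -> frobn (V *m B) = frobn B.
Proof.
move=> h; apply/eqP; rewrite -(@eqrXn2 _ 2) // !frobn_sqr_tr trmx_mul.
by rewrite mulmxA -(mulmxA _ V^T) h mulmx1.
Qed.

Lemma opb_orth m n (V : 'M[R]_(m, n)) : V^T *m V = 1%:M -> opb V 1.
Proof. by move=> h p B; rewrite frobn_orth // mul1r. Qed.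

(** Pythagoras: [Q *m B] and [(1%:M - Q) *m B] are orthogonal. *)
Lemma opb_proj n (Q : 'M[R]_n) : Q^T = Q -> Q *m Q = Q -> opb Q 1.
Proof.
move=> sQ iQ p B; rewrite mul1r -(@ler_pXn2r _ 2) ?nnegrE //.
have e : B = Q *m B + (1%:M - Q) *m B by rewrite -mulmxDl addrC subrK mul1mx.
have -> : frobn B ^+ 2 = frobn (Q *m B) ^+ 2 + frobn ((1%:M - Q) *m B) ^+ 2.
  rewrite {1}e frobnD_sqr trmx_mul sQ -mulmxA (mulmxA Q) mulmxBr mulmx1 iQ subrr.
  by rewrite mul0mx mulmx0 mxtrace0 mulr0 addr0.
by rewrite lerDl sqr_ge0.
Qed.

Lemma projC_sym n (Q : 'M[R]_n) : Q^T = Q -> (1%:M - Q)^T = 1%:M - Q.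
Proof. by move=> h; rewrite linearB /= trmx1 h. Qed.

Lemma projC_idem n (Q : 'M[R]_n) : Q *m Q = Q -> (1%:M - Q) *m (1%:M - Q) = 1%:M - Q.
Proof. by move=> h; rewrite mulmxBl mul1mx mulmxBr mulmx1 h subrr subr0. Qed.

Lemma VVT_sym m n (V : 'M[R]_(m, n)) : (V *m V^T)^T = V *m V^T.
Proof. by rewrite trmx_mul trmxK. Qed.

Lemma VVT_idem m n (V : 'M[R]_(m, n)) : V^T *m V = 1%:M ->
  V *m V^T *m (V *m V^T) = V *m V^T.
Proof. by move=> h; rewrite mulmxA -(mulmxA V) h mulmx1. Qed.

Lemma specn_bounded m n (A : 'M[R]_(m, n)) :
  has_sup [set vnorm (A *m x) | x in [set x : 'cV[R]_n | vnorm x <= 1]].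
Proof.
split.
  by exists (vnorm (A *m 0)), 0 => //=; rewrite vnormE frobn0.
exists (frobn A) => _ [x /= hx <-]; rewrite vnormE in hx; rewrite vnormE.
by rewrite (le_trans (frobnM _ _)) // ler_piMr.
Qed.

Lemma specn_ge0 m n (A : 'M[R]_(m, n)) : 0 <= specn A.
Proof.
apply: (le_trans _ (sup_upper_bound (specn_bounded A) _)); last first.
  by exists 0 => //=; rewrite vnormE frobn0.
by rewrite vnormE.
Qed.

Lemma specn_le_frobn m n (A : 'M[R]_(m, n)) : specn A <= frobn A.
Proof.
apply: ge_sup; first by case: (specn_bounded A).
move=> _ [x /= hx <-]; rewrite vnormE in hx; rewrite vnormE.
by rewrite (le_trans (frobnM _ _)) // ler_piMr.
Qed.

Lemma opb_specn m n (A : 'M[R]_(m, n)) : opb A (specn A).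
Proof.
apply: opb_col => [|x]; first exact: specn_ge0.
have [x0|x0] := eqVneq (frobn x) 0.
  by rewrite (frobn_eq0 x0) mulmx0 !frobn0 mulr0.
have px : 0 < frobn x by rewrite lt_def x0 /=.
have := sup_upper_bound (specn_bounded A).
move=> /(_ (vnorm (A *m ((frobn x)^-1 *: x)))).
rewrite -ler_pdivrMr // vnormE -scalemxAr frobnZ ger0_norm ?invr_ge0 // mulrC.
move=> -> //; exists ((frobn x)^-1 *: x); rewrite /= ?vnormE.
  by rewrite frobnZ ger0_norm ?invr_ge0 // mulVf.
by rewrite -scalemxAr frobnZ ger0_norm ?invr_ge0 // mulrC.
Qed.

End Frobenius.
#[export] Hint Extern 0 (is_true (0 <= frobn _)) => exact: frobn_ge0 : core.

(** * Leading eigenvectors and projectors *)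

Section Spectral.
Variable R : realType.
Implicit Types m n p q N r : nat.

(** Full column rank. It makes the Gram matrix a unit; otherwise [invmx] inside [projm] is only a
    default value and [projm] need not project. *)
Definition injmx {m n} (L : 'M[R]_(m, n)) := forall z : 'cV[R]_n, L *m z = 0 -> z = 0.

Lemma tr_quad_diagv m n (lam : 'I_m -> R) (x : 'M[R]_(m, n)) :
  \tr (x^T *m (diagv lam *m x)) = \sum_i \sum_j lam i * x i j ^+ 2.
Proof.
rewrite dotE; apply: eq_bigr => i _; apply: eq_bigr => j _.
by rewrite mul_diag_mx !mxE mulrCA expr2.
Qed.

Lemma kernel_vec p r (G : 'M[R]_(p, r)) : (p < r)%N ->
  exists2 z : 'cV[R]_r, z != 0 & G *m z = 0.
Proof.
move=> pr; have k0 : kermx G^T != 0.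
  rewrite -mxrank_eq0 mxrank_ker -lt0n subn_gt0 mxrank_tr.
  by rewrite (leq_ltn_trans (rank_leq_row G)).
exists (nz_row (kermx G^T))^T; first by rewrite trmx_eq0 nz_row_eq0.
apply: trmx_inj; rewrite trmx_mul trmxK trmx0.
by apply/sub_kermxP; exact: nz_row_sub.
Qed.

(** The last clause is the min-max principle: an [r]-dimensional trial space contains, for each
    [j < r], a nonzero vector orthogonal to the [j] eigenvectors before index [j], and its Rayleigh
    quotient is at most [lam j]. *)
Lemma leading_eigvecsP N r (S : 'M[R]_N) (V : 'M[R]_(N, r)) :
  (r <= N)%N -> leading_eigvecs S V ->
  exists lam : 'I_r -> R, [/\ V^T *m V = 1%:M, S *m V = V *m diagv lam &
    forall (L : 'M[R]_(N, r)) mu, injmx L ->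
      (forall z : 'cV[R]_r, mu * frobn (L *m z) ^+ 2 <= \tr ((L *m z)^T *m (S *m (L *m z)))) ->
      forall j, mu <= lam j].
Proof.
move=> rN /(_ rN) [U [lam [oU SE mono colE]]].
have oU' : U *m U^T = 1%:M by exact: mulmx1C.
pose w := widen_ord rN.
have VE i j : V i j = U i (w j).
  by have /matrixP/(_ i 0) := colE (w j) j erefl; rewrite !mxE.
exists (fun j => lam (w j)); split.
- apply/matrixP => i j; have /matrixP/(_ (w i) (w j)) := oU; rewrite !mxE => h.
  rewrite -[RHS]/((i == j)%:R) [i == j](_ : _ = (w i == w j)) -?h //.
  by apply: eq_bigr => k _; rewrite !mxE !VE.
- have SU : S *m U = U *m diagv lam by rewrite SE -mulmxA oU mulmx1.
  apply/matrixP => i j; have /matrixP/(_ i (w j)) := SU.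
  rewrite !mul_mx_diag !mxE VE => <-; apply: eq_bigr => k _.
  by rewrite VE.
move=> L mu injL quad j.
pose e (i : 'I_j) : 'I_N := w (widen_ord (ltnW (ltn_ord j)) i).
have [z z0 Gz] := kernel_vec (rowsub e (U^T *m L)) (ltn_ord j).
set x := L *m z; pose y := U^T *m x.
have x0 : 0 < frobn x ^+ 2.
  rewrite exprn_gt0 // lt_def frobn_ge0 andbT.
  apply/eqP => /frobn_eq0/injL zz; by rewrite zz eqxx in z0.
have xy : frobn x ^+ 2 = frobn y ^+ 2.
  by rewrite /y (frobn_orth (V := U^T)) // trmxK.
have ySy : \tr (x^T *m (S *m x)) = \tr (y^T *m (diagv lam *m y)).
  by rewrite /y (trmx_mul U^T) trmxK SE !mulmxA.
have ylow (i : 'I_N) : (i < j)%N -> y i 0 = 0.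
  move=> ij; have /matrixP/(_ (Ordinal ij) 0) := Gz.
  rewrite mxE [RHS]mxE => h; rewrite /y /x mulmxA mxE -[RHS]h.
  by apply: eq_bigr => k _; rewrite !mxE; congr (_ * _); apply: eq_bigr => l _;
     rewrite !mxE; congr (U _ _ * _); exact: val_inj.
(* In the eigen-coordinates [y], the entries below [j] vanish and all others carry an eigenvalue at
   most [lam j]. *)
rewrite -(ler_pM2r x0) (le_trans (quad z)) // -/x ySy tr_quad_diagv xy frobn_sqr.
rewrite mulr_sumr ler_sum // => i _; rewrite !big_ord1.
have [ij|ji] := ltnP i j; first by rewrite ylow // expr0n !mulr0.
by rewrite ler_wpM2r ?sqr_ge0 // mono.
Qed.

Lemma leading_eigvecs_orth N r (S : 'M[R]_N) (V : 'M[R]_(N, r)) :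
  (r <= N)%N -> leading_eigvecs S V -> V^T *m V = 1%:M.
Proof. by move=> rN /(leading_eigvecsP rN)[? []]. Qed.

(* A one-sided Davis-Kahan bound: by Courant-Fischer on the range of [L], the
   leading eigenvalues are at least [mu]. *)
Lemma leading_eigvecs_gap N r p (S : 'M[R]_N) (V L : 'M[R]_(N, r)) (B : 'M[R]_(p, N)) (mu : R) :
  (r <= N)%N -> leading_eigvecs S V -> injmx L -> 0 <= mu ->
  (forall z : 'cV[R]_r, mu * frobn (L *m z) ^+ 2 <= \tr ((L *m z)^T *m (S *m (L *m z)))) ->
  mu * frobn (B *m V) <= frobn (B *m (S *m V)).
Proof.
move=> rN /(leading_eigvecsP rN)[lam [_ SV lamP]] iL mu0 quad.
(* As [S *m V = V *m diagv lam], the right side is [B *m V] with column [j] multiplied by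
   [lam j >= mu]. *)
rewrite -(@ler_pXn2r _ 2) ?nnegrE ?mulr_ge0 // exprMn SV mulmxA !frobn_sqr mulr_sumr.
apply: ler_sum => i _; rewrite mulr_sumr; apply: ler_sum => j _.
rewrite mul_mx_diag [in X in _ <= X]mxE exprMn mulrC ler_wpM2l ?sqr_ge0 // mxE.
have lj := lamP _ _ iL quad j.
by rewrite ler_pXn2r ?nnegrE // (le_trans mu0 lj).
Qed.

Lemma injmx_gram m n (L : 'M[R]_(m, n)) : injmx L -> L^T *m L \in unitmx.
Proof.
move=> iL; rewrite -row_free_unit; apply: inj_row_free => v hv.
apply: trmx_inj; rewrite trmx0; apply/iL/frobn_eq0/eqP.
by rewrite -sqrf_eq0 frobn_sqr_tr trmx_mul trmxK mulmxA -(mulmxA v) hv mul0mx mxtrace0.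
Qed.

Lemma injmx_lb m n (L : 'M[R]_(m, n)) (l C : R) : 0 < l ->
  (forall z : 'cV[R]_n, l * frobn z ^+ 2 <= C * frobn (L *m z) ^+ 2) -> injmx L.
Proof.
move=> l0 h z Lz; apply/frobn_eq0/eqP; rewrite -sqrf_eq0 eq_le sqr_ge0 andbT.
by have := h z; rewrite Lz frobn0 expr0n mulr0 pmulr_rle0.
Qed.

Section Projm.
Variables (m n : nat) (L : 'M[R]_(m, n)).
Hypothesis iL : injmx L.

Let uL : L^T *m L \in unitmx. Proof. exact: injmx_gram. Qed.

Lemma projm_sym : (projm L)^T = projm L.
Proof.
by rewrite /projm !trmx_mul trmxK trmx_inv trmx_mul trmxK mulmxA.
Qed.

Lemma projm_id : projm L *m L = L.
Proof. by rewrite /projm -!mulmxA mulVmx // mulmx1. Qed.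

Lemma projm_idem : projm L *m projm L = projm L.
Proof. by rewrite {2}/projm !mulmxA projm_id. Qed.

Lemma mxtrace_projm : \tr (projm L) = n%:R.
Proof. by rewrite /projm -mulmxA mxtrace_mulC -mulmxA mulVmx // mxtrace1. Qed.

Lemma projmC_mul : (1%:M - projm L) *m L = 0.
Proof. by rewrite mulmxBl mul1mx projm_id subrr. Qed.

Lemma opb_projm : opb (projm L) 1.
Proof. exact: opb_proj projm_sym projm_idem. Qed.

Lemma opb_projmC : opb (1%:M - projm L) 1.
Proof. by apply: opb_proj; [exact/projC_sym/projm_sym|exact/projC_idem/projm_idem]. Qed.

Lemma frobn_projmC_sqr (V : 'M[R]_(m, n)) : V^T *m V = 1%:M ->
  frobn ((1%:M - projm L) *m V) ^+ 2 = n%:R - \tr (projm L *m (V *m V^T)).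
Proof.
move=> oV; rewrite frobn_sqr_tr trmx_mul projC_sym ?projm_sym // -mulmxA.
rewrite (mulmxA (1%:M - _)) projC_idem ?projm_idem // mulmxBl mul1mx mulmxBr oV.
by rewrite linearB /= mxtrace1 mxtrace_mulC -mulmxA.
Qed.

(** Both projectors have trace [n], so the expanded square is [2 (n - tr(P V V^T))]: the sine-theta
    identity. *)
Lemma frobn_projmB_sqr (V : 'M[R]_(m, n)) : V^T *m V = 1%:M ->
  frobn (V *m V^T - projm L) ^+ 2 = 2 * frobn ((1%:M - projm L) *m V) ^+ 2.
Proof.
move=> oV; rewrite frobnD_sqr frobnN frobn_projmC_sqr // !frobn_sqr_tr.
rewrite VVT_sym projm_sym projm_idem VVT_idem // mxtrace_projm mulmxN linearN /=.
by rewrite (mxtrace_mulC V) oV mxtrace1 (mxtrace_mulC _ (projm L)); ring.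
Qed.

Lemma frobn_projmB (V : 'M[R]_(m, n)) : V^T *m V = 1%:M ->
  frobn (V *m V^T - projm L) <= 2 * frobn ((1%:M - projm L) *m V).
Proof.
move=> oV; rewrite -(@ler_pXn2r _ 2) ?nnegrE ?mulr_ge0 // frobn_projmB_sqr // exprMn.
by rewrite ler_wpM2r ?sqr_ge0 // expr2; lra.
Qed.

(** Subspaces of equal dimension are equally far from each other in both directions: both squares
    are [n - tr(P V V^T)]. *)
Lemma frobn_orthC_projm (V : 'M[R]_(m, n)) : V^T *m V = 1%:M ->
  frobn ((1%:M - V *m V^T) *m projm L) = frobn ((1%:M - projm L) *m V).
Proof.
move=> oV; apply/eqP; rewrite -(@eqrXn2 _ 2) // frobn_projmC_sqr // frobn_sqr_tr.
rewrite trmx_mul projC_sym ?VVT_sym // projm_sym -mulmxA (mulmxA (1%:M - _)).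
rewrite projC_idem ?VVT_idem // mulmxBl mul1mx mulmxBr linearB /= projm_idem.
by rewrite mxtrace_projm (mxtrace_mulC _ (_ *m projm L)) -(mulmxA _ (projm L)) projm_idem (mxtrace_mulC _ (projm L)).
Qed.

(** Cauchy-Schwarz on [||L z||^2 = <z, L^T L z>], followed by the hypothesis on [||z||]. It carries
    a lower bound on the singular values of [L] over to [L^T] on the range of [L]. *)
Lemma frobn_trmx_range (l : R) (z : 'cV[R]_n) :
  (forall z : 'cV[R]_n, l * frobn z ^+ 2 <= frobn (L *m z) ^+ 2) ->
  l * frobn (L *m z) ^+ 2 <= frobn (L^T *m (L *m z)) ^+ 2.
Proof.
move=> /(_ z) h; set y := L *m z in h *.
have := dot_le z (L^T *m y).
rewrite mulmxA -trmx_mul -/y -frobn_sqr_tr => h2.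
have [y0|y0] := eqVneq (frobn y) 0; first by rewrite y0 expr0n mulr0 sqr_ge0.
have py : 0 < frobn y ^+ 2 by rewrite exprn_gt0 // lt_def y0 /=.
have h3 : frobn y ^+ 2 ^+ 2 <= (frobn z * frobn (L^T *m y)) ^+ 2.
  by rewrite ler_pXn2r // ?nnegrE ?mulr_ge0 ?sqr_ge0.
have [l0|l0] := leP l 0.
  by rewrite (le_trans _ (sqr_ge0 _)) // pmulr_lle0.
rewrite -(ler_pM2r py); have := sqr_ge0 (frobn (L^T *m y)).
move: h3 h; rewrite (exprMn _ (frobn z)).
move: (frobn z ^+ 2) (frobn (L^T *m y) ^+ 2) (frobn y ^+ 2) py => a b c pc h3 h b0.
have h4 := ler_wpM2r b0 h; have h5 := ler_wpM2l (ltW l0) h3. lra.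
Qed.

End Projm.

End Spectral.

(** * Perturbation of principal subspaces *)

Section Pca.
Variable R : realType.
Implicit Types m n p q N r T : nat.

(** The deterministic content of a good sample. The first two clauses come from the convergence of
    the factor Gram matrix, the third from the order of the noise norm, the fourth from the moment
    bounds on factor-noise products summed over the [N] columns. *)
Definition regular_sample {T N r} (C : R) (F : 'M[R]_(T, r)) (E : 'M[R]_(T, N)) : Prop :=
  [/\ frobn F ^+ 2 <= C * T%:R,
      forall z : 'cV[R]_r, T%:R * frobn z ^+ 2 <= C * frobn (F *m z) ^+ 2,
      specn E ^+ 2 <= C * (maxn N T)%:R &
      frobn (F^T *m E) ^+ 2 <= C * (N%:R * T%:R)].

Lemma regular_sample_le T N r (C C' : R) (F : 'M[R]_(T, r)) (E : 'M[R]_(T, N)) :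
  C <= C' -> regular_sample C F E -> regular_sample C' F E.
Proof.
move=> CC [h1 h2 h3 h4]; split.
- by rewrite (le_trans h1) // ler_wpM2r.
- by move=> z; rewrite (le_trans (h2 z)) // ler_wpM2r ?sqr_ge0.
- by rewrite (le_trans h3) // ler_wpM2r.
- by rewrite (le_trans h4) // ler_wpM2r ?mulr_ge0.
Qed.

Lemma tr_gram m n (X : 'M[R]_(m, n)) (a : R) (y : 'cV[R]_n) :
  \tr (y^T *m ((a *: (X^T *m X)) *m y)) = a * frobn (X *m y) ^+ 2.
Proof.
by rewrite frobn_sqr_tr trmx_mul -scalemxAl -scalemxAr mxtraceZ !mulmxA.
Qed.

Lemma le_of_sqr (x y : R) : 0 <= y -> x ^+ 2 <= y ^+ 2 -> x <= y.
Proof.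
move=> y0 h; have [x0|x0] := leP x 0; first exact: le_trans x0 y0.
by rewrite -(@ler_pXn2r _ 2) // nnegrE ltW.
Qed.

(** Cruder than the exact value [sqrt r], which keeps square roots of ranks out of the constants. *)
Lemma frobn_orth_le N r (V : 'M[R]_(N, r)) : V^T *m V = 1%:M -> frobn V <= 1 + r%:R.
Proof.
move=> oV; have : frobn V ^+ 2 = r%:R by rewrite frobn_sqr_tr oV mxtrace1.
by have := sqr_ge0 (frobn V - 1); rewrite !expr2; have := ler0n R r; lra.
Qed.

Lemma pd_quad r (Sig : 'M[R]_r) : pd_distinct_eig Sig ->
  exists2 l : R, 0 < l & forall z : 'cV[R]_r, l * frobn z ^+ 2 <= \tr (z^T *m (Sig *m z)).
Proof.
move=> [U [lam [oU SE lam0 _]]].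
have oU' : U *m U^T = 1%:M by exact: mulmx1C.
(* Starting the minimum at [1] gives a positive value also when [r = 0]. *)
exists (\big[Num.min/1]_i lam i).
  by elim/big_ind: _ => // x y x0 y0; rewrite lt_min x0 y0.
move=> z; have zE : frobn z ^+ 2 = frobn (U^T *m z) ^+ 2 by rewrite frobn_orth // trmxK.
have -> : \tr (z^T *m (Sig *m z)) = \tr ((U^T *m z)^T *m (diagv lam *m (U^T *m z))).
  by rewrite trmx_mul trmxK SE !mulmxA.
rewrite zE frobn_sqr tr_quad_diagv mulr_sumr; apply: ler_sum => i _.
rewrite mulr_sumr; apply: ler_sum => j _.
by rewrite ler_wpM2r ?sqr_ge0 // bigmin_le_cond.
Qed.

(** A perturbation of operator norm [l] consumes at most half of a form bounded below by [2 * l]. *)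
Lemma gram_lb m n (F : 'M[R]_(m, n)) (a l : R) (Sig : 'M[R]_n) :
  (forall z : 'cV[R]_n, 2 * l * frobn z ^+ 2 <= \tr (z^T *m (Sig *m z))) ->
  opb (a *: (F^T *m F) - Sig) l ->
  forall z : 'cV[R]_n, l * frobn z ^+ 2 <= a * frobn (F *m z) ^+ 2.
Proof.
move=> hS hD z; rewrite -tr_gram.
have -> : a *: (F^T *m F) = Sig + (a *: (F^T *m F) - Sig) by rewrite addrC subrK.
set D := a *: _ - _ in hD *.
have h1 := dot_le z (- (D *m z)); rewrite mulmxN linearN /= frobnN in h1.
have h2 := ler_wpM2l (frobn_ge0 z) (hD _ z).
by have := hS z; rewrite (mulmxDl Sig) mulmxDr mxtraceD; lra.
Qed.

Lemma mxtrace_le_frobn n (B : 'M[R]_n) : \tr B <= (1 + n%:R) * frobn B.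
Proof.
have := dot_le 1%:M B; rewrite trmx1 mul1mx => h; apply: (le_trans h).
by rewrite ler_wpM2r // frobn_orth_le // trmx1 mul1mx.
Qed.

Lemma maxn_le_add (N T : nat) : (maxn N T)%:R <= N%:R + T%:R :> R.
Proof. by rewrite -natrD ler_nat geq_max leq_addr leq_addl. Qed.

Lemma sqrt_nat_ge1 (n : nat) : (0 < n)%N -> 1 <= Num.sqrt (n%:R : R).
Proof. by move=> n0; rewrite -[X in X <= _]sqrtr1 ler_sqrt ?ltr0n // ler1n. Qed.

(** The signal part of [X^T] has its range inside that of [L], so [1%:M - projm L] annihilates it
    and only noise terms remain on the right. Here [l] is the weakest squared loading strength
    ([N^alpha_s] for the target, [N] for a source), and the normalisation [a] cancels. *)
Lemma pca_bound T N r (F : 'M[R]_(T, r)) (L V : 'M[R]_(N, r)) (E : 'M[R]_(T, N))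
    (C l a : R) :
  let X := F *m L^T + E in
  (r <= N)%N -> (0 < T)%N -> 1 <= C -> 0 < l -> 0 < a ->
  regular_sample C F E -> frobn L ^+ 2 <= C * N%:R ->
  (forall z : 'cV[R]_r, l * frobn z ^+ 2 <= C * frobn (L *m z) ^+ 2) ->
  4 * C ^+ 3 * (maxn N T)%:R <= T%:R * l ->
  leading_eigvecs (a *: (X^T *m X)) V ->
  T%:R * l * frobn ((1%:M - projm L) *m V) <=
    4 * C ^+ 3 * (2 + r%:R) * (N%:R * Num.sqrt T%:R + T%:R).
Proof.
move=> X rN T0 C1 l0 a0 [F2 Flb E2 FE] L2 Llb small lead.
have C0 : 0 < C by lra.
have iL := injmx_lb l0 Llb.
have oV := leading_eigvecs_orth rN lead.
have XE : X^T = L *m F^T + E^T by rewrite /X linearD /= trmx_mul trmxK.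
have Ty : (0 : R) < T%:R by rewrite ltr0n.
set m : R := (maxn N T)%:R in E2 small.
(* The signal gives [T l / C^2]; half of it is lost with the cross term and, by [small], at most a
   quarter to the noise. *)
pose mu := T%:R * l / (4 * C ^+ 2).
have mu0 : 0 <= mu by rewrite /mu divr_ge0 // mulr_ge0 ?sqr_ge0 // ltW.
have quad (z : 'cV[R]_r) : mu * frobn (L *m z) ^+ 2 <= frobn (X *m (L *m z)) ^+ 2.
  have rg : forall w : 'cV[R]_r, l / C * frobn w ^+ 2 <= frobn (L *m w) ^+ 2.
    by move=> w; rewrite mulrAC ler_pdivrMr // [X in _ <= X]mulrC; exact: Llb.
  have := frobn_trmx_range z rg.
  set y := L *m z; set u := frobn (L^T *m y) ^+ 2; rewrite mulrAC ler_pdivrMr // => hu.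
  have hX := frobnD_sqr_ge (F *m (L^T *m y)) (E *m y).
  have -> : X *m y = F *m (L^T *m y) + E *m y by rewrite /X mulmxDl mulmxA.
  have hF := Flb (L^T *m y); rewrite -/u in hF.
  have hE : frobn (E *m y) ^+ 2 <= C * m * frobn y ^+ 2.
    apply: (@le_trans _ _ ((specn E * frobn y) ^+ 2)).
      by rewrite ler_pXn2r ?nnegrE ?mulr_ge0 ?specn_ge0 //; exact: opb_specn.
    by rewrite exprMn ler_wpM2r ?sqr_ge0.
  rewrite /mu mulrAC ler_pdivrMr ?mulr_gt0 ?exprn_gt0 //.
  have y2 : 0 <= frobn y ^+ 2 by exact: sqr_ge0.
  move: (frobn y ^+ 2) (frobn (F *m _) ^+ 2) (frobn (E *m y) ^+ 2)
    (frobn (_ + _) ^+ 2) hu hX hF hE y2 => Y f e x hu hX hF hE y2.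
  have a1 := ler_wpM2l (ltW Ty) hu.
  have a2 := ler_wpM2l (ltW C0) hF.
  have C2 : 0 <= C ^+ 2 by exact: sqr_ge0.
  have a3 := ler_wpM2l C2 hE.
  have a4 := ler_wpM2l C2 hX.
  have a5 := ler_wpM2r y2 small.
  lra.
have amu : 0 <= a * mu by rewrite mulr_ge0 // ltW.
have quadS (z : 'cV[R]_r) : a * mu * frobn (L *m z) ^+ 2 <=
    \tr ((L *m z)^T *m ((a *: (X^T *m X)) *m (L *m z))).
  by rewrite tr_gram -mulrA ler_wpM2l // ltW.
have := leading_eigvecs_gap (1%:M - projm L) rN lead iL amu quadS.
rewrite -scalemxAl -scalemxAr frobnZ (gtr0_norm a0) -mulrA ler_pM2l // => key.
have sT1 := sqrt_nat_ge1 T0; have sT2 : Num.sqrt T%:R ^+ 2 = T%:R :> R by rewrite sqr_sqrtr.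
have keyR : frobn ((1%:M - projm L) *m (X^T *m X *m V)) <=
    C * (2 + r%:R) * (N%:R * Num.sqrt T%:R + T%:R).
  have -> : X^T *m X *m V = L *m (F^T *m (X *m V)) + E^T *m (X *m V).
    by rewrite -mulmxA {1}XE mulmxDl -mulmxA.
  rewrite mulmxDr mulmxA projmC_mul // mul0mx add0r /X.
  have := opb_projmC iL (E^T *m ((F *m L^T + E) *m V)); rewrite mul1r => h; apply: (le_trans h).
  rewrite mulmxDl mulmxDr; apply: (le_trans (frobnD _ _)).
  (* The product [F^T E] is bounded as a whole: for [T > N] this is sharper than multiplying
     separate bounds on [F] and [E]. *)
  have h1 : frobn (E^T *m (F *m L^T *m V)) <= C * (N%:R * Num.sqrt T%:R).
    rewrite -mulmxA mulmxA; apply: (le_trans (frobnM _ _)).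
    have LV : frobn (L^T *m V) <= frobn L.
      by have := frobnM_opbr L^T ler01 (opb_orth oV); rewrite mulr1 frobn_trmx.
    apply: (@le_trans _ _ (frobn (F^T *m E) * frobn L)).
      by rewrite -(frobn_trmx (F^T *m E)) trmx_mul trmxK ler_wpM2l.
    apply: le_of_sqr; first by rewrite !mulr_ge0 // ltW.
    rewrite !exprMn sT2.
    have := ler_pM (sqr_ge0 _) (sqr_ge0 _) FE L2; lra.
  have h2 : frobn (E^T *m (E *m V)) <= C * (N%:R + T%:R) * (1 + r%:R).
    apply: (@le_trans _ _ (specn E * (specn E * frobn V))).
      apply: (le_trans (opb_trmx (specn_ge0 E) (@opb_specn _ _ _ E) _)).
      by rewrite ler_wpM2l ?specn_ge0 // opb_specn.
    rewrite mulrA -expr2; apply: ler_pM => //; first exact: sqr_ge0.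
      by rewrite (le_trans E2) // ler_wpM2l ?(ltW C0) // maxn_le_add.
    exact: frobn_orth_le.
  apply: (le_trans (lerD h1 h2)).
  have NsT : (N%:R : R) <= N%:R * Num.sqrt T%:R by rewrite ler_peMr.
  have c1 := ler_wpM2l (ltW C0) NsT.
  have r0 : 0 <= (r%:R : R) by [].
  have c2 := ler_wpM2r r0 c1.
  have c3 : 0 <= C * T%:R by rewrite mulr_ge0 ?ltW.
  lra.
have {}key := le_trans key keyR.
rewrite /mu mulrAC ler_pdivrMr ?mulr_gt0 ?exprn_gt0 // in key.
by apply: (le_trans key); rewrite le_eqVlt; apply/orP; left; apply/eqP; ring.
Qed.

(** On the range of [L] the form is at least [1 - eta], since [projm L] acts there as the identity
    and [B] is nonnegative. On the complement [B] returns at most [1 - kappa] times the error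
    itself, which the left side absorbs, leaving the factor [kappa - eta >= kappa / 2]. *)
Lemma weak_bound N s (L V : 'M[R]_(N, s)) (B D : 'M[R]_N) (kappa e eta : R) :
  (s <= N)%N -> injmx L -> (forall y : 'cV[R]_N, 0 <= \tr (y^T *m (B *m y))) ->
  opb B (1 - kappa) -> frobn (B *m projm L) <= e -> frobn D <= eta ->
  eta <= kappa / 2 -> kappa <= 1 ->
  leading_eigvecs (projm L + B + D) V ->
  kappa / 2 * frobn ((1%:M - projm L) *m V) <= e + eta.
Proof.
move=> sN iL Bpsd Bop BP De ek k1 lead.
have oV := leading_eigvecs_orth sN lead.
have e0 : 0 <= 1 - eta by lra.
have quadS (z : 'cV[R]_s) : (1 - eta) * frobn (L *m z) ^+ 2 <=
    \tr ((L *m z)^T *m ((projm L + B + D) *m (L *m z))).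
  set y := L *m z.
  have -> : (projm L + B + D) *m y = y + B *m y + D *m y.
    by rewrite !mulmxDl {1}/y mulmxA projm_id.
  rewrite !mulmxDr !mxtraceD -frobn_sqr_tr.
  have := dot_le y (- (D *m y)); rewrite mulmxN linearN /= frobnN => h.
  have h2 := ler_wpM2l (frobn_ge0 y) (frobnM D y).
  have h3 := ler_wpM2r (sqr_ge0 (frobn y)) De.
  by have := Bpsd y; lra.
have := leading_eigvecs_gap (1%:M - projm L) sN lead iL e0 quadS.
set Q := 1%:M - projm L.
have -> : Q *m ((projm L + B + D) *m V) =
    Q *m (B *m projm L *m V) + Q *m (B *m (Q *m V)) + Q *m (D *m V).
  have BV : B *m V = B *m projm L *m V + B *m (Q *m V).
    by rewrite -mulmxA -mulmxDr /Q -mulmxDl addrC subrK mul1mx.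
  have QP : Q *m (projm L *m V) = 0.
    by rewrite mulmxA /Q mulmxBl mul1mx projm_idem // subrr mul0mx.
  by rewrite (mulmxDl (projm L + B)) (mulmxDl (projm L)) BV !(mulmxDr Q) QP add0r.
move=> key.
have Q1 p (Z : 'M[R]_(N, p)) : frobn (Q *m Z) <= frobn Z.
  by have := opb_projmC iL Z; rewrite mul1r.
have V1 p (Z : 'M[R]_(p, N)) : frobn (Z *m V) <= frobn Z.
  by have := frobnM_opbr Z ler01 (opb_orth oV); rewrite mulr1.
have t1 := le_trans (Q1 _ (B *m projm L *m V)) (le_trans (V1 _ _) BP).
have t2 := le_trans (Q1 _ (B *m (Q *m V))) (Bop _ _).
have t3 := le_trans (Q1 _ (D *m V)) (le_trans (V1 _ _) De).
have := frobnD (Q *m (B *m projm L *m V) + Q *m (B *m (Q *m V))) (Q *m (D *m V)).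
have := frobnD (Q *m (B *m projm L *m V)) (Q *m (B *m (Q *m V))).
have := ler_wpM2r (frobn_ge0 (Q *m V)) ek.
lra.
Qed.

End Pca.

(** * The strong factors of the target *)

Section RowMx.
Variable R : realType.

Lemma frobn_row_mx_sqr m n1 n2 (A : 'M[R]_(m, n1)) (B : 'M[R]_(m, n2)) :
  frobn (row_mx A B) ^+ 2 = frobn A ^+ 2 + frobn B ^+ 2.
Proof.
rewrite !frobn_sqr -big_split; apply: eq_bigr => i _; rewrite big_split_ord /=.
by congr (_ + _); apply: eq_bigr => j _; rewrite ?row_mxEl ?row_mxEr.
Qed.

Lemma frobn_row_mxl m n1 n2 (A : 'M[R]_(m, n1)) (B : 'M[R]_(m, n2)) :
  frobn A <= frobn (row_mx A B).
Proof. by apply: le_of_sqr => //; rewrite frobn_row_mx_sqr lerDl sqr_ge0. Qed.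

Lemma frobn_row_mxr m n1 n2 (A : 'M[R]_(m, n1)) (B : 'M[R]_(m, n2)) :
  frobn B <= frobn (row_mx A B).
Proof. by apply: le_of_sqr => //; rewrite frobn_row_mx_sqr lerDr sqr_ge0. Qed.

Lemma frobn_row_mx_le m n1 n2 (A : 'M[R]_(m, n1)) (B : 'M[R]_(m, n2)) :
  frobn (row_mx A B) <= frobn A + frobn B.
Proof.
apply: le_of_sqr; first exact: addr_ge0.
by rewrite frobn_row_mx_sqr sqrrD; have := mulr_ge0 (frobn_ge0 A) (frobn_ge0 B); lra.
Qed.

Lemma frobn_col_mx_sqr m1 m2 n (A : 'M[R]_(m1, n)) (B : 'M[R]_(m2, n)) :
  frobn (col_mx A B) ^+ 2 = frobn A ^+ 2 + frobn B ^+ 2.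
Proof.
by rewrite -frobn_trmx tr_col_mx frobn_row_mx_sqr !frobn_trmx.
Qed.

End RowMx.

(** * Deflated target covariance: errors of the strong loadings and factors for given [Qw] *)

Section Strong.
Variables (R : realType) (T N q s : nat) (C : R).
Variables (Ls : 'M[R]_(N, q)) (Lw : 'M[R]_(N, s)).
Variables (Fs : 'M[R]_(T, q)) (Fw : 'M[R]_(T, s)) (E : 'M[R]_(T, N)).
Variables (Qw : 'M[R]_(N, s)) (Qs : 'M[R]_(N, q)).
Let L0 := row_mx Ls Lw.
Let F0 := row_mx Fs Fw.
Let X := F0 *m L0^T + E.
Let Mh := 1%:M - Qw *m Qw^T.
Let rho := frobn ((1%:M - projm Lw) *m Qw).
Let tau := frobn ((1%:M - projm Ls) *m Qs).
Let sN : R := Num.sqrt N%:R.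
Let sT : R := Num.sqrt T%:R.

Hypothesis qN : (q <= N)%N.
Hypothesis N_gt0 : (0 < N)%N.
Hypothesis T_gt0 : (0 < T)%N.
Hypothesis C_ge1 : 1 <= C.
Hypothesis good : regular_sample C F0 E.
Hypothesis L0_ub : frobn L0 ^+ 2 <= C * N%:R.
Hypothesis Ls_lb : forall z : 'cV[R]_q, N%:R * frobn z ^+ 2 <= C * frobn (Ls *m z) ^+ 2.
Hypothesis iLw : injmx Lw.
Hypothesis LwLs : projm Lw *m Ls = 0.
Hypothesis oQw : Qw^T *m Qw = 1%:M.
Hypothesis lead : leading_eigvecs (strong_mat X Qw) Qs.
Hypothesis small_m : 16 * C ^+ 3 * (maxn N T)%:R <= T%:R * N%:R.
Hypothesis small_rho : 8 * C ^+ 2 * rho ^+ 2 <= 1.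

Let N0 : 0 < N%:R :> R. Proof. by rewrite ltr0n. Qed.
Let T0 : 0 < T%:R :> R. Proof. by rewrite ltr0n. Qed.
Let C0 : 0 < C. Proof. exact: lt_le_trans ltr01 C_ge1. Qed.
Let iLs : injmx Ls. Proof. exact: injmx_lb N0 Ls_lb. Qed.
Let oQs : Qs^T *m Qs = 1%:M. Proof. exact: leading_eigvecs_orth qN lead. Qed.
Let rho0 : 0 <= rho. Proof. exact: frobn_ge0. Qed.
Let tau0 : 0 <= tau. Proof. exact: frobn_ge0. Qed.
Let sN1 : 1 <= sN. Proof. exact: sqrt_nat_ge1. Qed.
Let sT1 : 1 <= sT. Proof. exact: sqrt_nat_ge1. Qed.
Let sNp : 0 < sN. Proof. exact: lt_le_trans ltr01 sN1. Qed.
Let sTp : 0 < sT. Proof. exact: lt_le_trans ltr01 sT1. Qed.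
Let sN2 : sN ^+ 2 = N%:R. Proof. exact: sqr_sqrtr. Qed.
Let sT2 : sT ^+ 2 = T%:R. Proof. exact: sqr_sqrtr. Qed.

Let Mh_op p (Z : 'M[R]_(N, p)) : frobn (Mh *m Z) <= frobn Z.
Proof.
have /(_ _ Z) : opb Mh 1 by apply: opb_proj; [exact/projC_sym/VVT_sym|exact/projC_idem/VVT_idem].
by rewrite mul1r.
Qed.

Let sMh : Mh^T = Mh. Proof. exact/projC_sym/VVT_sym. Qed.

Let Qw_op p (Z : 'M[R]_(s, p)) : frobn (Qw *m Z) <= frobn Z.
Proof. by rewrite frobn_orth. Qed.

Let Qs_opr p (Z : 'M[R]_(p, N)) : frobn (Z *m Qs) <= frobn Z.
Proof. by have := frobnM_opbr Z ler01 (opb_orth oQs); rewrite mulr1. Qed.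

(** Since [projm Lw *m Ls = 0], only the part of [Qw] outside the weak space meets [Ls]. *)
Let QwLs : frobn (Qw^T *m Ls) <= rho * frobn Ls.
Proof.
have -> : Qw^T *m Ls = ((1%:M - projm Lw) *m Qw)^T *m Ls.
  by rewrite trmx_mul projC_sym ?projm_sym // -mulmxA mulmxBl LwLs subr0 mul1mx.
by apply: (le_trans (frobnM _ _)); rewrite frobn_trmx.
Qed.

(** [Lw = projm Lw *m Lw], and [Mh *m projm Lw] has norm [rho] by the symmetry of the distance
    between subspaces. *)
Let MhLw : frobn (Mh *m Lw) <= rho * frobn Lw.
Proof.
rewrite -[in X in X <= _](projm_id iLw) mulmxA; apply: (le_trans (frobnM _ _)).
by rewrite frobn_orthC_projm.
Qed.

Let LsLe : frobn Ls <= frobn L0. Proof. exact: frobn_row_mxl. Qed.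
Let LwLe : frobn Lw <= frobn L0. Proof. exact: frobn_row_mxr. Qed.

Let EMh_sqr (y : 'cV[R]_N) :
  frobn (E *m (Mh *m y)) ^+ 2 <= C * (maxn N T)%:R * frobn y ^+ 2.
Proof.
case: good => _ _ E2 _.
apply: (@le_trans _ _ ((specn E * frobn y) ^+ 2)).
  rewrite ler_pXn2r ?nnegrE ?mulr_ge0 ?specn_ge0 //; apply: (le_trans (@opb_specn _ _ _ E _ _)).
  by rewrite ler_wpM2l ?specn_ge0.
by rewrite exprMn ler_wpM2r ?sqr_ge0.
Qed.

(** Deflation by [Qw] costs the strong range only a term of order [rho], because [Ls] is orthogonal
    to [Lw]. In units of [T N ||y||^2 / C^2]: dropping a cross term leaves [1/2], [small_rho]
    removes [1/8], separating the noise halves the remaining [3/8], and [small_m] removes [1/16];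
    what is left is [1/8]. *)
Lemma strong_quad (z : 'cV[R]_q) :
  T%:R * N%:R / (8 * C ^+ 2) * frobn (Ls *m z) ^+ 2 <= frobn (X *m (Mh *m (Ls *m z))) ^+ 2.
Proof.
set y := Ls *m z; set v := L0^T *m (Mh *m y).
have -> : X *m (Mh *m y) = F0 *m v + E *m (Mh *m y) by rewrite /X mulmxDl -mulmxA.
have hX := frobnD_sqr_ge (F0 *m v) (E *m (Mh *m y)).
have hE := EMh_sqr y.
have hF : T%:R * frobn v ^+ 2 <= C * frobn (F0 *m v) ^+ 2 by case: good.
(* The weak coordinates of [v] are dropped. *)
have hv : frobn (Ls^T *m (Mh *m y)) ^+ 2 <= frobn v ^+ 2.
  by rewrite /v /L0 tr_row_mx mul_col_mx frobn_col_mx_sqr lerDl sqr_ge0.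
have hs : frobn (Ls^T *m (Qw *m (Qw^T *m y))) ^+ 2 <= C * N%:R * rho ^+ 2 * frobn y ^+ 2.
  apply: (@le_trans _ _ ((rho * frobn Ls * frobn y) ^+ 2)).
    rewrite ler_pXn2r ?nnegrE ?mulr_ge0 // mulmxA; apply: (le_trans (frobnM _ _)).
    apply: ler_pM => //; first by rewrite -frobn_trmx trmx_mul trmxK.
    by have := opb_trmx ler01 (opb_orth oQw) y; rewrite mul1r.
  rewrite !exprMn ler_wpM2r ?sqr_ge0 // mulrC ler_wpM2r ?sqr_ge0 //.
  by apply: le_trans L0_ub; rewrite ler_pXn2r ?nnegrE.
have hL := frobnD_sqr_ge (Ls^T *m y) (- (Ls^T *m (Qw *m (Qw^T *m y)))).
have vE : Ls^T *m (Mh *m y) = Ls^T *m y - Ls^T *m (Qw *m (Qw^T *m y)).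
  by rewrite /Mh mulmxBl mul1mx mulmxBr !mulmxA.
rewrite -vE frobnN in hL.
have hy : N%:R * frobn y ^+ 2 <= C * frobn (Ls^T *m y) ^+ 2.
  have rg : forall w : 'cV[R]_q, N%:R / C * frobn w ^+ 2 <= frobn (Ls *m w) ^+ 2.
    by move=> w; rewrite mulrAC ler_pdivrMr // [X in _ <= X]mulrC; exact: Ls_lb.
  by have := frobn_trmx_range z rg; rewrite mulrAC ler_pdivrMr // [X in _ <= X]mulrC.
rewrite mulrAC ler_pdivrMr ?mulr_gt0 ?exprn_gt0 //.
have y2 : 0 <= frobn y ^+ 2 by exact: sqr_ge0.
move: (frobn y ^+ 2) (frobn (F0 *m v) ^+ 2) (frobn (E *m _) ^+ 2) (frobn v ^+ 2)
  (frobn (F0 *m v + _) ^+ 2) (frobn (Ls^T *m (Mh *m y)) ^+ 2) (frobn (Ls^T *m (Qw *m _)) ^+ 2)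
  (frobn (Ls^T *m y) ^+ 2) y2 hX hE hF hv hs hL hy.
move=> y2 f e v2 x a b c y20 hX hE hF hv hs hL hy.
have C2 : 0 <= C ^+ 2 by exact: sqr_ge0.
have b1 := ler_wpM2l C2 hX.
have b2 := ler_wpM2l C2 hE.
have b3 := ler_wpM2l (ltW C0) hF.
have TC : 0 <= C * T%:R by rewrite mulr_ge0 // ltW.
have b4 := ler_wpM2l TC hv.
have b5 := ler_wpM2l TC hL.
have b6 := ler_wpM2l TC hs.
have b7 := ler_wpM2l (ltW T0) hy.
have b8 := ler_wpM2r y20 small_m.
have TNy : 0 <= T%:R * N%:R * y2 by rewrite !mulr_ge0 // ltW.
have b9 := ler_wpM2l TNy small_rho.
lra.
Qed.

Let Qs_le : frobn Qs <= 1 + q%:R. Proof. exact: frobn_orth_le. Qed.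

Let W := X *m (Mh *m Qs).

Let WE : W = F0 *m (L0^T *m (Mh *m Qs)) + E *m (Mh *m Qs).
Proof. by rewrite /W /X mulmxDl mulmxA. Qed.

Let K_le : frobn (L0^T *m (Mh *m Qs)) <= frobn L0.
Proof.
rewrite mulmxA; apply: (le_trans (Qs_opr _)).
by rewrite -frobn_trmx trmx_mul trmxK sMh Mh_op.
Qed.

Let EMQ_le : frobn (E *m (Mh *m Qs)) <= specn E * (1 + q%:R).
Proof.
apply: (le_trans (@opb_specn _ _ _ E _ _)); rewrite ler_wpM2l ?specn_ge0 //.
exact: le_trans (Mh_op _) Qs_le.
Qed.

Let c := Num.sqrt C.
Let c2 : c ^+ 2 = C. Proof. by rewrite sqr_sqrtr // ltW. Qed.
Let c1 : 1 <= c. Proof. by apply: le_of_sqr; rewrite ?sqrtr_ge0 // c2 expr1n. Qed.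
Let L0_le : frobn L0 <= c * sN.
Proof. by apply: le_of_sqr; rewrite ?mulr_ge0 ?sqrtr_ge0 // exprMn c2 sN2. Qed.
Let F0_le : frobn F0 <= c * sT.
Proof.
apply: le_of_sqr; rewrite ?mulr_ge0 ?sqrtr_ge0 // exprMn c2 sT2.
by case: good.
Qed.
Let E_le : specn E <= c * (sN + sT).
Proof.
have sNT : 0 <= sN * sT by rewrite mulr_ge0 ?sqrtr_ge0.
apply: le_of_sqr; first by rewrite ?mulr_ge0 ?addr_ge0 ?sqrtr_ge0.
case: good => _ _ E2 _; apply: (le_trans E2); rewrite exprMn c2 ler_wpM2l ?(ltW C0) //.
by apply: (le_trans (maxn_le_add _ _ _)); rewrite sqrrD sN2 sT2; lra.
Qed.
Let FE_le : frobn (F0^T *m E) <= c * (sN * sT).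
Proof.
apply: le_of_sqr; rewrite ?mulr_ge0 ?sqrtr_ge0 // !exprMn c2 sN2 sT2.
by case: good.
Qed.

(** The signal enters only through [(1 - P_s) Mh L0], of relative order [rho]; the products of [E^T]
    with [F0] and with [E] yield the other two terms. The constant is [8 C^2], from [strong_quad],
    times the [4 C^2] of the signal term. *)
Lemma strong_tau_le : tau <= 32 * C ^+ 4 * (2 + q%:R) * (rho + sT^-1 + N%:R^-1).
Proof.
pose mu := N%:R / (8 * C ^+ 2).
have mu0 : 0 <= mu by rewrite divr_ge0 // ?mulr_ge0 ?sqr_ge0 // ltW.
have SE p (Z : 'M[R]_(N, p)) :
    strong_mat X Qw *m Z = T%:R^-1 *: (Mh *m (X^T *m (X *m (Mh *m Z)))).
  by rewrite /strong_mat -/Mh -!mulmxA -!scalemxAl -scalemxAr -!mulmxA.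
have quad (z : 'cV[R]_q) : mu * frobn (Ls *m z) ^+ 2 <=
    \tr ((Ls *m z)^T *m (strong_mat X Qw *m (Ls *m z))).
  rewrite SE -scalemxAr mxtraceZ.
  have -> : (Ls *m z)^T *m (Mh *m (X^T *m (X *m (Mh *m (Ls *m z))))) =
      (X *m (Mh *m (Ls *m z)))^T *m (X *m (Mh *m (Ls *m z))).
    by rewrite (trmx_mul X) (trmx_mul Mh) sMh !mulmxA.
  rewrite -frobn_sqr_tr.
  rewrite -(ler_pM2l T0) [X in _ <= X]mulrA divff ?gt_eqF // mul1r.
  by have := strong_quad z; rewrite /mu; lra.
have := leading_eigvecs_gap (1%:M - projm Ls) qN lead iLs mu0 quad.
rewrite SE -scalemxAr frobnZ normfV (gtr0_norm T0) -/tau -/W => key.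
have Ps1 p (Z : 'M[R]_(N, p)) : frobn ((1%:M - projm Ls) *m Z) <= frobn Z.
  by have := opb_projmC iLs Z; rewrite mul1r.
have rb : 0 <= rho * frobn L0 by rewrite mulr_ge0.
(* In the strong block [1 - P_s] kills [Ls] and leaves [Qw Qw^T Ls]; the weak block is already
   nearly removed by [Mh]. *)
have PML : frobn ((1%:M - projm Ls) *m (Mh *m L0)) <= 2 * (rho * frobn L0).
  rewrite /L0 !mul_mx_row; apply: (le_trans (frobn_row_mx_le _ _)).
  have e1 : (1%:M - projm Ls) *m (Mh *m Ls) = - ((1%:M - projm Ls) *m (Qw *m (Qw^T *m Ls))).
    rewrite /Mh (mulmxBl 1%:M (Qw *m _)) mul1mx (mulmxBr (1%:M - projm Ls)).
    by rewrite projmC_mul // sub0r !mulmxA.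
  have p1 : frobn ((1%:M - projm Ls) *m (Mh *m Ls)) <= rho * frobn L0.
    rewrite e1 frobnN; apply: (le_trans (Ps1 _ _)); apply: (le_trans (Qw_op _)).
    by apply: (le_trans QwLs); rewrite ler_wpM2l.
  have p2 : frobn ((1%:M - projm Ls) *m (Mh *m Lw)) <= rho * frobn L0.
    apply: (le_trans (Ps1 _ _)); apply: (le_trans MhLw).
    by rewrite ler_wpM2l.
  by move: p1 p2; rewrite /L0; lra.
have k0 : 0 <= (q%:R : R) by [].
have EMQ_leq := EMQ_le; set k : R := q%:R in k0 EMQ_leq *.
(* Both roots are at least [1]. The noise part of [W] thus fits under the order [sqrt (N T)] of its
   signal part. *)
have sNT : sN + sT <= 2 * (sN * sT).
  have a1 : 0 <= (sN - 1) * sT by rewrite mulr_ge0 ?subr_ge0 ?sqrtr_ge0.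
  have a2 : 0 <= (sT - 1) * sN by rewrite mulr_ge0 ?subr_ge0 ?sqrtr_ge0.
  lra.
have cge0 : 0 <= c by rewrite sqrtr_ge0.
have u0 : 0 <= sN * sT by rewrite mulr_ge0 ?sqrtr_ge0.
have W_le : frobn W <= 2 * C * (2 + k) * (sN * sT).
  rewrite WE; apply: (le_trans (frobnD _ _)).
  have w1 : frobn (F0 *m (L0^T *m (Mh *m Qs))) <= C * (sN * sT).
    apply: (le_trans (frobnM _ _)); apply: (le_trans (ler_pM _ _ F0_le (le_trans K_le L0_le))) => //.
    by rewrite -c2; lra.
  have w2 : frobn (E *m (Mh *m Qs)) <= 2 * C * (1 + k) * (sN * sT).
    apply: (le_trans EMQ_leq).
    have w3 : specn E <= C * (2 * (sN * sT)).
      apply: (le_trans E_le); apply: ler_pM => //; first by rewrite addr_ge0 ?sqrtr_ge0.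
      by rewrite -c2 expr2 ler_peMr.
    have k1 : 0 <= 1 + k by lra.
    have := ler_wpM2r k1 w3; lra.
  have := mulr_ge0 (ltW C0) u0; lra.
have t1 : frobn ((1%:M - projm Ls) *m (Mh *m (L0 *m (F0^T *m W)))) <=
    4 * C ^+ 2 * (2 + k) * (N%:R * T%:R) * rho.
  rewrite (mulmxA Mh) (mulmxA (1%:M - projm Ls)); apply: (le_trans (frobnM _ _)).
  have FW : frobn (F0^T *m W) <= c * sT * (2 * C * (2 + k) * (sN * sT)).
    by apply: (le_trans (frobnM _ _)); rewrite frobn_trmx; exact: ler_pM.
  have PML' : frobn ((1%:M - projm Ls) *m (Mh *m L0)) <= 2 * (rho * (c * sN)).
    by apply: (le_trans PML); rewrite ler_wpM2l // ler_wpM2l.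
  apply: (le_trans (ler_pM _ _ PML' FW)) => //.
  by rewrite le_eqVlt -sN2 -sT2 -c2; apply/orP; left; apply/eqP; ring.
have t2 : frobn ((1%:M - projm Ls) *m (Mh *m (E^T *m W))) <=
    C * (N%:R * sT) + C * (N%:R + T%:R) * (1 + k).
  apply: (le_trans (Ps1 _ _)); apply: (le_trans (Mh_op _)).
  rewrite WE mulmxDr; apply: (le_trans (frobnD _ _)); apply: lerD.
    rewrite mulmxA; apply: (le_trans (frobnM _ _)).
    rewrite -(frobn_trmx (E^T *m F0)) trmx_mul trmxK.
    apply: (le_trans (ler_pM _ _ FE_le (le_trans K_le L0_le))) => //.
    by rewrite le_eqVlt -sN2 -c2; apply/orP; left; apply/eqP; ring.
  apply: (le_trans (opb_trmx (specn_ge0 E) (@opb_specn _ _ _ E) _)).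
  apply: (le_trans (ler_wpM2l (specn_ge0 E) EMQ_leq)).
  rewrite mulrA -expr2 ler_wpM2r //; first by lra.
  by case: good => _ _ E2 _; apply: (le_trans E2); rewrite ler_wpM2l ?(ltW C0) // maxn_le_add.
have {}key : mu * tau * T%:R <= 4 * C ^+ 2 * (2 + k) * (N%:R * T%:R) * rho +
    (C * (N%:R * sT) + C * (N%:R + T%:R) * (1 + k)).
  rewrite -ler_pdivlMr // [X in _ <= X]mulrC; apply: (le_trans key).
  rewrite ler_wpM2l ?invr_ge0 ?(ltW T0) //.
  have -> : X^T *m W = L0 *m (F0^T *m W) + E^T *m W.
    by rewrite mulmxA -mulmxDl /X linearD /= trmx_mul trmxK.
  by rewrite (mulmxDr Mh) (mulmxDr (1%:M - projm Ls)) (le_trans (frobnD _ _)) // lerD.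
have sTi : sT^-1 * T%:R = sT by rewrite -sT2 expr2 mulrA mulVf ?mul1r // gt_eqF.
have NN : N%:R^-1 * N%:R = 1 :> R by rewrite mulVf // gt_eqF.
have TT : T%:R <= N%:R * T%:R :> R by rewrite ler_peMl ?ler1n // ltW.
have sTge : 1 <= sT by [].
have NT0 : 0 < N%:R * T%:R :> R by rewrite mulr_gt0.
rewrite -(ler_pM2r NT0).
have e1 : mu * tau * T%:R * (8 * C ^+ 2) = tau * (N%:R * T%:R).
  by rewrite /mu; field; rewrite gt_eqF.
have C82 : 0 <= 8 * C ^+ 2 by rewrite mulr_ge0 ?sqr_ge0.
have {}key := ler_wpM2r C82 key; rewrite e1 in key.
apply: (le_trans key).
have -> : 32 * C ^+ 4 * (2 + k) * (rho + sT^-1 + N%:R^-1) * (N%:R * T%:R) =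
   32 * C ^+ 4 * (2 + k) * (rho * (N%:R * T%:R) + N%:R * (sT^-1 * T%:R) + N%:R^-1 * N%:R * T%:R) by ring.
rewrite sTi NN mul1r.
have C34 : C ^+ 3 <= C ^+ 4 by rewrite [C ^+ 4]exprS ler_peMl // exprn_ge0 // ltW.
have NsT : (N%:R : R) <= N%:R * sT by rewrite ler_peMr // ltW.
have x0 : 0 <= (2 + k) * (N%:R * sT + T%:R).
  by rewrite mulr_ge0 ?addr_ge0 ?mulr_ge0 ?(ltW N0) ?(ltW T0) ?sqrtr_ge0.
have d1 : 8 * C ^+ 3 * ((2 + k) * (N%:R * sT + T%:R)) <= 8 * C ^+ 4 * ((2 + k) * (N%:R * sT + T%:R)).
  by rewrite ler_wpM2r // ler_wpM2l.
have C30 : 0 <= C ^+ 3 by rewrite exprn_ge0 // ltW.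
have d2 : 0 <= C ^+ 4 * ((2 + k) * (N%:R * sT + T%:R)).
  by rewrite mulr_ge0 // exprn_ge0 // ltW.
have d3 : C ^+ 3 * (1 + k) * N%:R <= C ^+ 3 * (1 + k) * (N%:R * sT).
  by rewrite ler_wpM2l // mulr_ge0 // addr_ge0.
have d4 : 0 <= C ^+ 3 * T%:R by rewrite mulr_ge0 // ltW.
have d5 : 0 <= C ^+ 3 * (N%:R * sT) by rewrite mulr_ge0 // mulr_ge0 ?sqrtr_ge0 ?(ltW N0).
lra.
Qed.

Definition rotation : 'M[R]_q := sN *: (invmx (Ls^T *m Ls) *m (Ls^T *m Qs)).

Let LsH : Ls *m rotation = sN *: (projm Ls *m Qs).
Proof. by rewrite /rotation -scalemxAr /projm !mulmxA. Qed.

Lemma frobn_loading_err : frobn (Ls_hat Qs - Ls *m rotation) = sN * tau.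
Proof.
rewrite LsH /Ls_hat -/sN -scalerBr frobnZ ger0_norm ?sqrtr_ge0 //.
by rewrite /tau mulmxBl mul1mx.
Qed.

Hypothesis small_tau : tau <= 2^-1.

(** [Ls H x / sN = P_s Qs x] differs from [Qs x], whose norm is [||x||], by at most
    [tau ||x|| <= ||x|| / 2]. This serves twice: [rotation] is injective, and [x = invmx rotation]
    bounds its inverse. *)
Let rot_lb p (x : 'M[R]_(q, p)) : frobn x <= 2 * c * frobn (rotation *m x).
Proof.
have h1 : frobn (Ls *m (rotation *m x)) <= c * sN * frobn (rotation *m x).
  apply: (le_trans (frobnM _ _)); rewrite ler_wpM2r //.
  exact: le_trans LsLe L0_le.
have h2 : Ls *m (rotation *m x) = sN *: (Qs *m x - (1%:M - projm Ls) *m Qs *m x).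
  rewrite mulmxA LsH -scalemxAl; congr (_ *: _).
  by rewrite !mulmxBl mul1mx opprB addrC subrK.
have h3 : frobn x <= frobn (Qs *m x - (1%:M - projm Ls) *m Qs *m x) +
    frobn ((1%:M - projm Ls) *m Qs *m x).
  rewrite -{1}(frobn_orth x oQs).
  by have := frobnD (Qs *m x - (1%:M - projm Ls) *m Qs *m x) ((1%:M - projm Ls) *m Qs *m x); rewrite subrK.
have h4 : frobn ((1%:M - projm Ls) *m Qs *m x) <= tau * frobn x by exact: frobnM.
have h5 := ler_wpM2r (frobn_ge0 x) small_tau.
rewrite h2 frobnZ ger0_norm ?sqrtr_ge0 // -mulrA mulrCA ler_pM2l // in h1.
lra.
Qed.

Lemma rotation_unit : rotation \in unitmx.
Proof.
rewrite -unitmx_tr -row_free_unit; apply: inj_row_free => v hv.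
apply: trmx_inj; rewrite trmx0; apply/frobn_eq0/eqP; rewrite eq_le frobn_ge0 andbT.
have := rot_lb v^T; have -> : rotation *m v^T = 0.
  by apply: trmx_inj; rewrite trmx_mul trmxK hv trmx0.
by rewrite frobn0 mulr0.
Qed.

Variable dw : 'I_s -> R.
Hypothesis dw_gt0 : forall i, 0 < dw i.

(** The scales [dw] cancel in [Lw_hat Dw^-1 Lw_hat^T = Qw Qw^T], so subtracting the weak fit is the
    same deflation [Mh]. *)
Lemma Fs_hatE : Fs_hat X Qw dw Qs = sN^-1 *: W.
Proof.
have DD : diagv (fun i => Num.sqrt (dw i)) *m diagv (fun i => (dw i)^-1) *m
    (diagv (fun i => Num.sqrt (dw i)))^T = 1%:M :> 'M[R]_s.
  apply/matrixP => i j; rewrite tr_diag_mx mul_mx_diag mxE mul_mx_diag !mxE.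
  have [->|_] := eqVneq i j; last by rewrite mulr0n !mul0r.
  by rewrite mulr1n mulrAC -expr2 sqr_sqrtr ?ltW // divff // gt_eqF.
have -> : Fs_hat X Qw dw Qs = N%:R^-1 *: (X *m Mh *m (sN *: Qs)).
  rewrite /Fs_hat /Fw_hat /Lw_hat /Ls_hat -/sN; congr (_ *: (_ *m _)).
  rewrite /Mh mulmxBr mulmx1; congr (_ - _).
  rewrite trmx_mul -!mulmxA; congr (_ *m (_ *m _)).
  by rewrite mulmxA mulmxA DD mul1mx.
rewrite -scalemxAr scalerA -mulmxA -/W; congr (_ *: _).
by rewrite -sN2 expr2 invfM -mulrA mulVf ?mulr1 // gt_eqF.
Qed.

(** Up to deflation terms the estimator multiplies [Fs] by [G = Ls^T Qs / sqrt N], and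
    [H^T G = Qs^T P_s Qs] is the identity minus a term quadratic in the subspace error; hence [G] is
    close to the inverse of [H^T]. The remainder consists of two terms of order [rho] and the
    projected noise. *)
Lemma frobn_factor_err :
  frobn (Fs_hat X Qw dw Qs - Fs *m invmx rotation^T) <=
    2 * C * (2 + q%:R) * sT * (tau + rho + sT^-1 + sN^-1).
Proof.
pose Hi := invmx rotation^T.
have uH : rotation^T \in unitmx by rewrite unitmx_tr rotation_unit.
pose G := sN^-1 *: (Ls^T *m Qs).
have k0 : 0 <= (q%:R : R) by [].
have EMQ_leq := EMQ_le; set k : R := q%:R in k0 EMQ_leq *.
have cge0 : 0 <= c by rewrite sqrtr_ge0.
have cC : c <= C by rewrite -c2 expr2 ler_peMr.
have Hi_le : frobn Hi <= 2 * c * (1 + k).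
  have := rot_lb (invmx rotation); rewrite mulmxV ?rotation_unit // /Hi -trmx_inv frobn_trmx.
  move=> h; apply: (le_trans h); rewrite ler_wpM2l ?mulr_ge0 //.
  by apply: frobn_orth_le; rewrite trmx1 mul1mx.
have GH : G - Hi = Hi *m - (((1%:M - projm Ls) *m Qs)^T *m ((1%:M - projm Ls) *m Qs)).
  have HG : rotation^T *m G = 1%:M - ((1%:M - projm Ls) *m Qs)^T *m ((1%:M - projm Ls) *m Qs).
    have rT : rotation^T = sN *: (invmx (Ls^T *m Ls) *m (Ls^T *m Qs))^T.
      by rewrite /rotation linearZ.
    rewrite rT /G -scalemxAl -scalemxAr scalerA divff ?gt_eqF // scale1r.
    rewrite [X in _ = _ - X *m _]trmx_mul projC_sym ?projm_sym // -(mulmxA Qs^T) (mulmxA (1%:M - _)).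
    rewrite projC_idem ?projm_idem // (mulmxBl 1%:M) mul1mx mulmxBr oQs opprB addrCA subrr addr0.
    by rewrite !trmx_mul trmx_inv trmx_mul !trmxK /projm !mulmxA.
  rewrite -[G](mulKmx uH) HG -/Hi mulmxBr mulmx1 mulmxN.
  by rewrite addrC addKr.
have GH_le : frobn (G - Hi) <= 2 * c * (1 + k) * tau.
  rewrite GH; apply: (le_trans (frobnM _ _)); rewrite frobnN.
  (* The quadratic bound [tau ^+ 2] is relaxed to [tau], as [tau <= 1]. *)
  have tt : frobn (((1%:M - projm Ls) *m Qs)^T *m ((1%:M - projm Ls) *m Qs)) <= tau.
    apply: (le_trans (frobnM _ _)); rewrite frobn_trmx -/tau ler_piMr //.
    by apply: (le_trans small_tau); rewrite invf_le1 ?ler1n.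
  exact: ler_pM.
rewrite Fs_hatE WE.
have -> : F0 *m (L0^T *m (Mh *m Qs)) = Fs *m (Ls^T *m (Mh *m Qs)) + Fw *m (Lw^T *m (Mh *m Qs)).
  by rewrite /F0 /L0 tr_row_mx mul_col_mx mul_row_col.
have dec : Ls^T *m (Mh *m Qs) = Ls^T *m Qs - Ls^T *m (Qw *m (Qw^T *m Qs)).
  by rewrite /Mh mulmxBl mul1mx mulmxBr !mulmxA.
have -> : sN^-1 *: (Fs *m (Ls^T *m (Mh *m Qs)) + Fw *m (Lw^T *m (Mh *m Qs)) + E *m (Mh *m Qs))
    - Fs *m Hi = Fs *m (G - Hi) + sN^-1 *: (- (Fs *m (Ls^T *m (Qw *m (Qw^T *m Qs)))) +
      Fw *m (Lw^T *m (Mh *m Qs)) + E *m (Mh *m Qs)).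
  rewrite dec mulmxBr /G mulmxBr -scalemxAr !scalerDr.
  by rewrite -!addrA; congr (_ + _); rewrite [RHS]addrC -!addrA.
have p1 : frobn (Fs *m (G - Hi)) <= c * sT * (2 * c * (1 + k) * tau).
  apply: (le_trans (frobnM _ _)); apply: ler_pM => //.
  exact: le_trans (frobn_row_mxl _ _) F0_le.
have p2 : frobn (Fs *m (Ls^T *m (Qw *m (Qw^T *m Qs)))) <= c * sT * (rho * (c * sN)).
  apply: (le_trans (frobnM _ _)); apply: ler_pM => //.
    exact: le_trans (frobn_row_mxl _ _) F0_le.
  rewrite 2!mulmxA; apply: (le_trans (Qs_opr _)).
  apply: (le_trans (frobnM_opbr _ ler01 (opb_trmx ler01 (opb_orth oQw)))); rewrite mulr1.
  rewrite -frobn_trmx trmx_mul trmxK; apply: (le_trans QwLs).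
  by rewrite ler_wpM2l // (le_trans LsLe).
have p3 : frobn (Fw *m (Lw^T *m (Mh *m Qs))) <= c * sT * (rho * (c * sN)).
  apply: (le_trans (frobnM _ _)); apply: ler_pM => //.
    exact: le_trans (frobn_row_mxr _ _) F0_le.
  rewrite mulmxA; apply: (le_trans (Qs_opr _)).
  rewrite -frobn_trmx trmx_mul trmxK sMh; apply: (le_trans MhLw).
  by rewrite ler_wpM2l // (le_trans LwLe).
have p4 : frobn (E *m (Mh *m Qs)) <= c * (sN + sT) * (1 + k).
  by apply: (le_trans EMQ_leq); rewrite ler_wpM2r // addr_ge0.
apply: (le_trans (frobnD _ _)); rewrite frobnZ gtr0_norm ?invr_gt0 //.
set Z := - _ + _ + _.
have Zle : frobn Z <= 2 * (c * sT * (rho * (c * sN))) + c * (sN + sT) * (1 + k).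
  have := frobnD (- (Fs *m (Ls^T *m (Qw *m (Qw^T *m Qs)))) + Fw *m (Lw^T *m (Mh *m Qs))) (E *m (Mh *m Qs)).
  have := frobnD (- (Fs *m (Ls^T *m (Qw *m (Qw^T *m Qs))))) (Fw *m (Lw^T *m (Mh *m Qs))).
  by rewrite frobnN -/Z; lra.
have {}Zle : sN^-1 * frobn Z <= 2 * C * sT * rho + c * (1 + k) * sT * (sT^-1 + sN^-1).
  have sNi : 0 <= sN^-1 by rewrite invr_ge0 ltW.
  apply: (le_trans (ler_wpM2l sNi Zle)); rewrite le_eqVlt -c2; apply/orP; left; apply/eqP.
  by field; rewrite !gt_eqF.
apply: (le_trans (lerD p1 Zle)).
have i1 : 0 <= sT * (sT^-1 + sN^-1).
  by rewrite mulr_ge0 ?addr_ge0 ?invr_ge0 ?sqrtr_ge0.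
have k1 : 0 <= 1 + k by rewrite addr_ge0.
have i2 := ler_wpM2r (mulr_ge0 k1 i1) cC.
have i3 : 0 <= C * (k * (sT * rho)) by rewrite !mulr_ge0 ?sqrtr_ge0 ?(ltW C0).
have i4 : 0 <= C * (k * (sT * (sT^-1 + sN^-1))) by rewrite mulr_ge0 ?(ltW C0) // mulr_ge0.
have i5 : 0 <= C * (sT * (sT^-1 + sN^-1)) by rewrite mulr_ge0 ?(ltW C0).
have i6 : 0 <= C * (sT * tau) by rewrite !mulr_ge0 ?sqrtr_ge0 ?(ltW C0).
have i7 : 0 <= C * (sT * rho) by rewrite !mulr_ge0 ?sqrtr_ge0 ?(ltW C0).
have -> : c * sT * (2 * c * (1 + k) * tau) = 2 * C * (1 + k) * (sT * tau) by rewrite -c2; ring.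
lra.
Qed.


End Strong.

(** * The oracle estimator for fixed dimensions *)

Section Misc.
Variable R : realType.

(** Idempotence of the sum forces [PQ + QP = 0]; multiplying by [P] on either side gives
    [PQ = - PQP = QP], so [2 PQ = 0]. This turns the additive splits of projectors into
    orthogonality. *)
Lemma proj_add_orth n (P Q : 'M[R]_n) : P *m P = P -> Q *m Q = Q ->
  (P + Q) *m (P + Q) = P + Q -> P *m Q = 0.
Proof.
move=> PP QQ; rewrite mulmxDl !mulmxDr PP QQ => h.
have h1 : P *m Q + Q *m P = 0.
  apply: (addrI (P + Q)); rewrite addr0 -[RHS]h addrACA; congr (_ + _).
  by rewrite addrC.
have h2 : P *m Q = - (P *m Q *m P).
  apply/eqP; rewrite -addr_eq0; apply/eqP.
  by have := congr1 (mulmx P) h1; rewrite mulmxDr mulmx0 !mulmxA PP.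
have h3 : P *m Q *m P = - (Q *m P).
  apply/eqP; rewrite -addr_eq0; apply/eqP.
  by have := congr1 (mulmx^~ P) h1; rewrite /= mulmxDl mul0mx -(mulmxA Q) PP.
have h4 : P *m Q = Q *m P by rewrite h2 h3 opprK.
have : 2%:R *: (P *m Q) = 0 by rewrite scaler_nat mulr2n {2}h4.
by move/eqP; rewrite scaler_eq0 pnatr_eq0 => /eqP.
Qed.

Lemma projm_split m n n1 n2 (L : 'M[R]_(m, n)) (L1 : 'M[R]_(m, n1)) (L2 : 'M[R]_(m, n2)) :
  injmx L -> injmx L1 -> injmx L2 -> projm L = projm L1 + projm L2 ->
  projm L1 *m projm L2 = 0.
Proof.
move=> iL i1 i2 h; apply: proj_add_orth; rewrite ?projm_idem //.
by rewrite -h projm_idem.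
Qed.

Lemma injmx_row_mxl m n1 n2 (A : 'M[R]_(m, n1)) (B : 'M[R]_(m, n2)) :
  injmx (row_mx A B) -> injmx A.
Proof.
move=> h z Az; have /h/eqP : row_mx A B *m col_mx z 0 = 0.
  by rewrite mul_row_col Az mulmx0 addr0.
by rewrite col_mx_eq0 => /andP[/eqP].
Qed.

Lemma injmx_row_mxr m n1 n2 (A : 'M[R]_(m, n1)) (B : 'M[R]_(m, n2)) :
  injmx (row_mx A B) -> injmx B.
Proof.
move=> h z Az; have /h/eqP : row_mx A B *m col_mx 0 z = 0.
  by rewrite mul_row_col Az mulmx0 addr0.
by rewrite col_mx_eq0 => /andP[_ /eqP].
Qed.

Lemma injmx_colsel m n (L : 'M[R]_(m, n)) (S : {set 'I_n}) :
  injmx L -> injmx (colsel L S).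
Proof.
move=> iL z; pose e (j : 'I_#|S|) : 'I_n := enum_val j.
rewrite /colsel -[L in colsub _ L]mulmx1 -mulmx_colsub -mulmxA => /iL h.
have -> : z = rowsub e (colsub e 1%:M *m z).
  rewrite -mul_rowsub_mx -[LHS]mul1mx; congr (_ *m _); apply/matrixP => i j.
  by rewrite !mxE (inj_eq enum_val_inj).
by rewrite h; apply/matrixP => i j; rewrite !mxE.
Qed.

Lemma tr_quad_projm m n (L : 'M[R]_(m, n)) (y : 'cV[R]_m) : injmx L ->
  0 <= \tr (y^T *m (projm L *m y)).
Proof.
move=> iL; rewrite -(projm_idem iL) -{1}(projm_sym L) -mulmxA mulmxA -trmx_mul.
by rewrite -frobn_sqr_tr sqr_ge0.
Qed.

End Misc.

Section Oracle.
Variables (R : realType) (q s K : nat) (A : {set 'I_K}) (r : 'I_K -> nat) (C kappa : R).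

(** The constants follow the chain of bounds. Each [8 C^3 (2 + r)] is the constant of [pca_bound]
    doubled by the passage to projectors, and the final [1] pays for [eps]; [rho_cst] solves
    [weak_bound], and [tau_cst], [fac_cst] insert the result into [strong_tau_le] and
    [frobn_factor_err]. *)
Definition weak_cst : R :=
  8 * C ^+ 3 * ((2 + (q + s)%:R) + \sum_(k in A) (2 + (r k)%:R)) + 1.
Definition rho_cst : R := 2 * (weak_cst + 1) / kappa.
Definition tau_cst : R := 32 * C ^+ 4 * (2 + q%:R) * (rho_cst + 1).
Definition fac_cst : R := 2 * C * (2 + q%:R) * (tau_cst + rho_cst + 1).

Variables (N T0 : nat) (Tk : 'I_K -> nat) (nu eps : R).
Variables (Ls : 'M[R]_(N, q)) (Lw : 'M[R]_(N, s)) (Lk : forall k, 'M[R]_(N, r k)).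
Variables (S : forall k, {set 'I_(r k)}).
Variables (Fs : 'M[R]_(T0, q)) (Fw : 'M[R]_(T0, s)) (E0 : 'M[R]_(T0, N)).
Variables (Fk : forall k, 'M[R]_(Tk k, r k)) (Ek : forall k, 'M[R]_(Tk k, N)).
Variables (Q0 : 'M[R]_(N, q + s)) (Qk : forall k, 'M[R]_(N, r k)).
Variables (Qw : 'M[R]_(N, s)) (Qs : 'M[R]_(N, q)).
Let Tt := (T0 + \sum_(k in A) Tk k)%N.
Let L0 := row_mx Ls Lw.
Let F0 := row_mx Fs Fw.
Let X0 := F0 *m L0^T + E0.
Let Xk k := Fk k *m (Lk k)^T + Ek k.

(* The bracket in the paper's delta, with [nu] standing for N^alpha_s. *)
Definition weak_rate : R :=
  Num.sqrt (T0%:R) * N%:R / (Tt%:R * nu) + T0%:R / (Tt%:R * nu)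
   + (Num.sqrt (Tt%:R))^-1 + (N%:R)^-1 + eps.
Let g := weak_rate.

Hypothesis C1 : 1 <= C.
Hypothesis N0 : (0 < N)%N.
Hypothesis T00 : (0 < T0)%N.
Hypothesis Tk0 : forall k, k \in A -> (0 < Tk k)%N.
Hypothesis qsN : (q + s <= N)%N.
Hypothesis rN : forall k, k \in A -> (r k <= N)%N.
Hypothesis nu0 : 0 < nu.
Hypothesis kappa0 : 0 < kappa.
Hypothesis good0 : regular_sample C F0 E0.
Hypothesis goodk : forall k, k \in A -> regular_sample C (Fk k) (Ek k).
Hypothesis L0_ub : frobn L0 ^+ 2 <= C * N%:R.
Hypothesis Lk_ub : forall k, k \in A -> frobn (Lk k) ^+ 2 <= C * N%:R.
Hypothesis L0_lb : forall z : 'cV[R]_(q + s), nu * frobn z ^+ 2 <= C * frobn (L0 *m z) ^+ 2.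
Hypothesis Lk_lb : forall k, k \in A ->
  forall z : 'cV[R]_(r k), N%:R * frobn z ^+ 2 <= C * frobn (Lk k *m z) ^+ 2.
Hypothesis small0 : 4 * C ^+ 3 * (maxn N T0)%:R <= T0%:R * nu.
Hypothesis smallk : forall k, k \in A -> 4 * C ^+ 3 * (maxn N (Tk k))%:R <= (Tk k)%:R * N%:R.
Hypothesis split0 : projm L0 = projm Lw + projm Ls.
Hypothesis splitk : forall k, k \in A ->
  projm (Lk k) = projm (colsel (Lk k) (S k)) + projm (colsel (Lk k) (~: S k)).
Hypothesis eps0 : 0 <= eps.
Hypothesis closek : forall k, k \in A ->
  frobn (projm (colsel (Lk k) (S k)) - projm Lw) <= eps.
Hypothesis gap : Tt%:R^-1 * specn (T0%:R *: projm Ls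
   + \sum_(k in A) (Tk k)%:R *: projm (colsel (Lk k) (~: S k))) <= 1 - kappa.
Hypothesis leadQ0 : leading_eigvecs (((N * T0)%N)%:R^-1 *: (X0^T *m X0)) Q0.
Hypothesis leadQk : forall k, k \in A ->
  leading_eigvecs (((N * Tk k)%N)%:R^-1 *: ((Xk k)^T *m Xk k)) (Qk k).
Hypothesis leadQw : leading_eigvecs (Tt%:R^-1 *: (T0%:R *: (Q0 *m Q0^T)
   + \sum_(k in A) (Tk k)%:R *: (Qk k *m (Qk k)^T))) Qw.

Let iL0 : injmx L0. Proof. exact: injmx_lb nu0 L0_lb. Qed.
Let iLs : injmx Ls. Proof. exact: injmx_row_mxl iL0. Qed.
Let iLw : injmx Lw. Proof. exact: injmx_row_mxr iL0. Qed.
Let Np : 0 < N%:R :> R. Proof. by rewrite ltr0n. Qed.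
Let iLk k : k \in A -> injmx (Lk k). Proof. by move=> kA; exact: injmx_lb Np (Lk_lb kA). Qed.
Let Cp : 0 < C. Proof. exact: lt_le_trans ltr01 C1. Qed.
Let C3 : 0 <= C ^+ 3. Proof. by rewrite exprn_ge0 // ltW. Qed.
Let Ttp : 0 < Tt%:R :> R. Proof. by rewrite ltr0n /Tt addn_gt0 T00. Qed.
Let TtE : Tt%:R = T0%:R + \sum_(k in A) (Tk k)%:R :> R.
Proof. by rewrite /Tt natrD natr_sum. Qed.
Let sTp : 0 < Num.sqrt Tt%:R :> R. Proof. by rewrite sqrtr_gt0. Qed.

Let PwPs : projm Lw *m projm Ls = 0.
Proof. exact: projm_split iL0 iLw iLs split0. Qed.

Lemma projm_weak_strong : projm Lw *m Ls = 0.
Proof. by rewrite -{1}(projm_id iLs) mulmxA PwPs mul0mx. Qed.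

(** The weakest target direction has strength only [nu], but the weight [T0 / Tt] brings the error
    down to the first two terms of [weak_rate]. *)
Let d0_le : T0%:R * frobn (Q0 *m Q0^T - projm L0) <=
  8 * C ^+ 3 * (2 + (q + s)%:R) * (Tt%:R * g).
Proof.
have a0 : 0 < ((N * T0)%N)%:R^-1 :> R by rewrite invr_gt0 ltr0n muln_gt0 N0.
have h := pca_bound qsN T00 C1 nu0 a0 good0 L0_ub L0_lb small0 leadQ0.
have oQ := leading_eigvecs_orth qsN leadQ0.
have h2 := frobn_projmB iL0 oQ.
set x := frobn ((1%:M - projm L0) *m Q0) in h h2.
have h3 : T0%:R * x <= 4 * C ^+ 3 * (2 + (q + s)%:R) *
    (Num.sqrt T0%:R * N%:R / nu + T0%:R / nu).
  rewrite -(ler_pM2r nu0); apply: le_trans (_ : T0%:R * nu * x <= _); first by rewrite mulrAC.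
  apply: (le_trans h); rewrite le_eqVlt; apply/orP; left; apply/eqP.
  by field; rewrite gt_eqF.
have h4 : Num.sqrt T0%:R * N%:R / nu + T0%:R / nu <= Tt%:R * g.
  have -> : Tt%:R * g = Num.sqrt T0%:R * N%:R / nu + T0%:R / nu +
     Tt%:R * ((Num.sqrt (Tt%:R))^-1 + (N%:R)^-1 + eps).
    by rewrite /g /weak_rate; field; rewrite !gt_eqF.
  by rewrite lerDl mulr_ge0 // !addr_ge0 ?invr_ge0 ?sqrtr_ge0.
have c0 : 0 <= 4 * C ^+ 3 * (2 + (q + s)%:R) by rewrite mulr_ge0 ?addr_ge0 // mulr_ge0.
have h5 := ler_wpM2l c0 h4.
have h6 := ler_wpM2l (ler0n R T0) h2.
lra.
Qed.

(** All source loadings have strength [N], so the weighted error is of order [sqrt Tk + Tk / N], at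
    most [Tt (Tt^-1/2 + N^-1)]. *)
Let dk_le k : k \in A -> (Tk k)%:R * frobn (Qk k *m (Qk k)^T - projm (Lk k)) <=
  8 * C ^+ 3 * (2 + (r k)%:R) * (Tt%:R * g).
Proof.
move=> kA.
have a0 : 0 < ((N * Tk k)%N)%:R^-1 :> R by rewrite invr_gt0 ltr0n muln_gt0 N0 Tk0.
have h := pca_bound (rN kA) (Tk0 kA) C1 Np a0 (goodk kA) (Lk_ub kA) (Lk_lb kA) (smallk kA) (leadQk kA).
have oQ := leading_eigvecs_orth (rN kA) (leadQk kA).
have h2 := frobn_projmB (iLk kA) oQ.
set x := frobn ((1%:M - projm (Lk k)) *m Qk k) in h h2.
have h3 : (Tk k)%:R * x <= 4 * C ^+ 3 * (2 + (r k)%:R) *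
    (Num.sqrt (Tk k)%:R + (Tk k)%:R / N%:R).
  rewrite -(ler_pM2r Np); apply: le_trans (_ : (Tk k)%:R * N%:R * x <= _); first by rewrite mulrAC.
  apply: (le_trans h); rewrite le_eqVlt; apply/orP; left; apply/eqP.
  by field; rewrite gt_eqF.
have TT : (Tk k)%:R <= Tt%:R :> R.
  by rewrite ler_nat /Tt (bigD1 k) //= addnCA leq_addr.
have h4 : Num.sqrt (Tk k)%:R + (Tk k)%:R / N%:R <= Tt%:R * g.
  apply: (@le_trans _ _ (Tt%:R * ((Num.sqrt (Tt%:R))^-1 + (N%:R)^-1))).
    rewrite mulrDr; apply: lerD; last by rewrite ler_wpM2r // invr_ge0.
    rewrite -[X in X / _](@sqr_sqrtr _ Tt%:R) // expr2 mulfK ?gt_eqF //.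
    by rewrite ler_sqrt.
  rewrite ler_wpM2l // /g /weak_rate.
  have a1 : 0 <= Num.sqrt T0%:R * N%:R / (Tt%:R * nu).
    by rewrite !mulr_ge0 ?sqrtr_ge0 // invr_ge0 mulr_ge0 // ltW.
  have a2 : 0 <= T0%:R / (Tt%:R * nu) by rewrite !mulr_ge0 // invr_ge0 mulr_ge0 // ltW.
  by move: a1 a2 eps0; lra.
have c0 : 0 <= 4 * C ^+ 3 * (2 + (r k)%:R) by rewrite mulr_ge0 ?addr_ge0 // mulr_ge0.
have h5 := ler_wpM2l c0 h4.
have h6 := ler_wpM2l (ler0n R (Tk k)) h2.
lra.
Qed.

Lemma weak_rho_bound : weak_cst * g <= kappa / 2 ->
  frobn ((1%:M - projm Lw) *m Qw) <= rho_cst * g.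
Proof.
move=> small.
(* The averaged empirical projector is compared with [projm Lw + B], where [B] collects the
   directions that are not to be transferred. *)
pose Bs := T0%:R *: projm Ls + \sum_(k in A) (Tk k)%:R *: projm (colsel (Lk k) (~: S k)).
pose B := Tt%:R^-1 *: Bs.
pose Sh := T0%:R *: (Q0 *m Q0^T) + \sum_(k in A) (Tk k)%:R *: (Qk k *m (Qk k)^T).
pose D := Tt%:R^-1 *: Sh - (projm Lw + B).
have icolk k (kA : k \in A) Z : injmx (colsel (Lk k) Z) by exact/injmx_colsel/iLk.
have sleN : (s <= N)%N by rewrite (leq_trans _ qsN) // leq_addl.
have Ti0 : 0 <= Tt%:R^-1 :> R by rewrite invr_ge0.
have Bpsd (y : 'cV[R]_N) : 0 <= \tr (y^T *m (B *m y)).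
  rewrite /B -scalemxAl -scalemxAr mxtraceZ mulr_ge0 // /Bs mulmxDl mulmxDr mxtraceD.
  rewrite addr_ge0 //.
    by rewrite -scalemxAl -scalemxAr mxtraceZ mulr_ge0 // tr_quad_projm.
  rewrite mulmx_suml mulmx_sumr raddf_sum; apply: sumr_ge0 => k kA.
  by rewrite /= -scalemxAl -scalemxAr mxtraceZ mulr_ge0 // tr_quad_projm //; exact: icolk.
have Bop : opb B (1 - kappa).
  move=> p Z; rewrite /B -scalemxAl frobnZ (ger0_norm Ti0).
  apply: (@le_trans _ _ (Tt%:R^-1 * (specn Bs * frobn Z))).
    by rewrite ler_wpM2l // opb_specn.
  by rewrite mulrA ler_wpM2r.
have k1 : kappa <= 1.
  by have := mulr_ge0 Ti0 (specn_ge0 Bs); have := gap; rewrite -/Bs; lra.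
have epsT : \sum_(k in A) (Tk k)%:R * eps <= Tt%:R * eps.
  by rewrite -mulr_suml ler_wpM2r // TtE lerDr.
have BP : frobn (B *m projm Lw) <= eps.
  rewrite /B -scalemxAl frobnZ (ger0_norm Ti0) mulrC ler_pdivrMr // mulrC.
  apply: le_trans epsT; rewrite /Bs mulmxDl -scalemxAl.
  have -> : projm Ls *m projm Lw = 0.
    by rewrite -[LHS]trmxK trmx_mul !projm_sym PwPs trmx0.
  rewrite scaler0 add0r mulmx_suml; apply: (le_trans (frobn_sum _ _ _)).
  apply: ler_sum => k kA; rewrite -scalemxAl frobnZ ger0_norm // ler_wpM2l //.
  have TcT : projm (colsel (Lk k) (~: S k)) *m projm (colsel (Lk k) (S k)) = 0.
    apply: projm_split (iLk kA) _ _ _; [exact: icolk|exact: icolk|].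
    by rewrite (splitk kA) addrC.
  (* By orthogonality inside source [k], [projm Lw] may be replaced by its difference to the
     transferred projector, of size [eps]. *)
  have -> : projm (colsel (Lk k) (~: S k)) *m projm Lw =
      projm (colsel (Lk k) (~: S k)) *m - (projm (colsel (Lk k) (S k)) - projm Lw).
    by rewrite opprB mulmxBr TcT subr0.
  have := opb_projm (icolk k kA (~: S k)) (- (projm (colsel (Lk k) (S k)) - projm Lw)).
  by rewrite mul1r frobnN => h; exact: le_trans h (closek kA).
have De : frobn D <= weak_cst * g.
  rewrite -(ler_pM2l Ttp).
  have -> : Tt%:R * frobn D = frobn (Tt%:R *: D) by rewrite frobnZ gtr0_norm.
  (* Writing [Tt] as the sum of the sample sizes gives each sample its own copy of [projm Lw]; a
     source then contributes its estimation error and its discrepancy from the target. *)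
  have -> : Tt%:R *: D = T0%:R *: (Q0 *m Q0^T - projm L0) +
      \sum_(k in A) (Tk k)%:R *: ((Qk k *m (Qk k)^T - projm (Lk k)) +
        (projm (colsel (Lk k) (S k)) - projm Lw)).
    have -> : Tt%:R *: D = Sh - (Tt%:R *: projm Lw + Bs).
      by rewrite /D /B scalerBr (scalerDr _ (projm Lw)) !scalerA mulfV ?gt_eqF // !scale1r.
    rewrite TtE scalerDl scaler_suml /Sh /Bs split0.
    have -> : \sum_(k in A) (Tk k)%:R *: ((Qk k *m (Qk k)^T - projm (Lk k)) +
        (projm (colsel (Lk k) (S k)) - projm Lw)) =
        \sum_(k in A) (Tk k)%:R *: (Qk k *m (Qk k)^T) - (\sum_(k in A) (Tk k)%:R *: projm Lw +
          \sum_(k in A) (Tk k)%:R *: projm (colsel (Lk k) (~: S k))).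
      rewrite -big_split -sumrB /=; apply: eq_bigr => k kA.
      rewrite (splitk kA) -scalerDr -scalerBr; congr (_ *: _).
      move: (Qk k *m _) (projm Lw) (projm (colsel (Lk k) (S k))) (projm (colsel (Lk k) (~: S k))) => a b c d.
      by apply/matrixP => i j; rewrite !mxE; ring.
    move: (Q0 *m _) (projm Lw) (projm Ls) (\sum_(k in A) _) (\sum_(k in A) _) (\sum_(k in A) _).
    by move=> a b c d e f; apply/matrixP => i j; rewrite !mxE; ring.
  apply: (le_trans (frobnD _ _)); rewrite frobnZ ger0_norm //.
  have h1 : frobn (\sum_(k in A) (Tk k)%:R *: ((Qk k *m (Qk k)^T - projm (Lk k)) +
        (projm (colsel (Lk k) (S k)) - projm Lw))) <=
      \sum_(k in A) 8 * C ^+ 3 * (2 + (r k)%:R) * (Tt%:R * g) + Tt%:R * eps.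
    apply: (le_trans (frobn_sum _ _ _)).
    apply: (@le_trans _ _ (\sum_(k in A) (8 * C ^+ 3 * (2 + (r k)%:R) * (Tt%:R * g) + (Tk k)%:R * eps))).
      apply: ler_sum => k kA; rewrite frobnZ ger0_norm //.
      apply: (@le_trans _ _ ((Tk k)%:R * (frobn (Qk k *m (Qk k)^T - projm (Lk k)) + eps))).
        by rewrite ler_wpM2l // (le_trans (frobnD _ _)) // lerD2l closek.
      by rewrite mulrDr lerD2r dk_le.
    by rewrite big_split /= lerD2l.
  apply: (le_trans (lerD d0_le h1)).
  have epsg : eps <= g.
    by rewrite /g /weak_rate lerDr !addr_ge0 ?divr_ge0 ?mulr_ge0 ?invr_ge0 ?sqrtr_ge0 ?(ltW nu0).
  rewrite -mulr_suml -mulr_sumr /weak_cst.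
  have := ler_wpM2l (ltW Ttp) epsg; lra.
have lead : leading_eigvecs (projm Lw + B + D) Qw.
  by rewrite /D addrC subrK.
have h := weak_bound sleN iLw Bpsd Bop BP De small k1 lead.
have epsg : eps <= g.
  by rewrite /g /weak_rate lerDr !addr_ge0 ?divr_ge0 ?mulr_ge0 ?invr_ge0 ?sqrtr_ge0 ?(ltW nu0).
rewrite /rho_cst mulrAC ler_pdivlMr //; lra.
Qed.

Variable dw : 'I_s -> R.
Let u : R := g + (Num.sqrt T0%:R)^-1 + (Num.sqrt N%:R)^-1.
Hypothesis Ls_lb : forall z : 'cV[R]_q, N%:R * frobn z ^+ 2 <= C * frobn (Ls *m z) ^+ 2.
Hypothesis dw_gt0 : forall i, 0 < dw i.
Hypothesis leadQs : leading_eigvecs (strong_mat X0 Qw) Qs.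
Hypothesis small_strong : 16 * C ^+ 3 * (maxn N T0)%:R <= T0%:R * N%:R.
Hypothesis small_weak : weak_cst * u <= kappa / 2.
Hypothesis small_rho : 8 * C ^+ 2 * (rho_cst * u) ^+ 2 <= 1.
Hypothesis small_tau : tau_cst * u <= 2^-1.

Lemma oracle_bound :
  [/\ rotation Ls Qs \in unitmx,
      (Num.sqrt N%:R)^-1 * specn (Ls_hat Qs - Ls *m rotation Ls Qs) <= tau_cst * u &
      (Num.sqrt T0%:R)^-1 * specn (Fs_hat X0 Qw dw Qs - Fs *m invmx (rotation Ls Qs)^T)
        <= fac_cst * u].
Proof.
have sN0 : 0 < Num.sqrt N%:R :> R by rewrite sqrtr_gt0.
have sT0 : 0 < Num.sqrt T0%:R :> R by rewrite sqrtr_gt0 ltr0n.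
have iN0 : 0 <= (Num.sqrt N%:R)^-1 :> R by rewrite invr_ge0 ltW.
have iT0 : 0 <= (Num.sqrt T0%:R)^-1 :> R by rewrite invr_ge0 ltW.
have g0 : 0 <= g.
  by rewrite /g /weak_rate !addr_ge0 ?divr_ge0 ?mulr_ge0 ?invr_ge0 ?sqrtr_ge0 ?(ltW nu0).
have gu : g <= u by rewrite /u -addrA lerDl addr_ge0.
have w0 : 0 <= weak_cst.
  rewrite addr_ge0 // mulr_ge0 //; first by rewrite mulr_ge0.
  by rewrite addr_ge0 ?addr_ge0 // sumr_ge0 // => k _; rewrite addr_ge0.
have rc0 : 0 <= rho_cst.
  by rewrite /rho_cst mulr_ge0 ?invr_ge0 ?(ltW kappa0) // mulr_ge0 // addr_ge0.
have rho_le : frobn ((1%:M - projm Lw) *m Qw) <= rho_cst * g.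
  by apply: weak_rho_bound; apply: le_trans small_weak; rewrite ler_wpM2l.
have rho_leu : frobn ((1%:M - projm Lw) *m Qw) <= rho_cst * u.
  by apply: (le_trans rho_le); rewrite ler_wpM2l.
have sleN : (s <= N)%N by rewrite (leq_trans _ qsN) // leq_addl.
have qleN : (q <= N)%N by rewrite (leq_trans _ qsN) // leq_addr.
have oQw := leading_eigvecs_orth sleN leadQw.
have small_rho' : 8 * C ^+ 2 * frobn ((1%:M - projm Lw) *m Qw) ^+ 2 <= 1.
  have C8 : 0 <= 8 * C ^+ 2 by rewrite mulr_ge0 ?sqr_ge0.
  apply: le_trans small_rho; rewrite ler_wpM2l //.
  by rewrite ler_pXn2r // ?nnegrE // (le_trans _ rho_leu).
have q0 : 0 <= q%:R :> R by [].
have tau_le : frobn ((1%:M - projm Ls) *m Qs) <= tau_cst * u.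
  apply: (le_trans (strong_tau_le qleN N0 T00 C1 good0 L0_ub Ls_lb iLw projm_weak_strong
    oQw leadQs small_strong small_rho')).
  rewrite /tau_cst -[X in _ <= X]mulrA ler_wpM2l //.
    by rewrite mulr_ge0 ?addr_ge0 // mulr_ge0 // exprn_ge0 // ltW.
  (* With this the term [N^-1] of the bound on [tau] is covered by [u]. *)
  have iN : (N%:R)^-1 <= (Num.sqrt N%:R)^-1 :> R.
    rewrite lef_pV2 ?posrE // -{2}(@sqr_sqrtr _ N%:R) // expr2 ler_peMr ?(ltW sN0) //.
    exact: sqrt_nat_ge1.
  have := rho_leu; rewrite /u; lra.
have tau2 := le_trans tau_le small_tau.
split.
- exact: (rotation_unit qleN N0 C1 L0_ub leadQs tau2).
- rewrite ler_pdivrMl //; apply: (le_trans (specn_le_frobn _)).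
  by rewrite frobn_loading_err ler_wpM2l // ltW.
rewrite ler_pdivrMl //; apply: (le_trans (specn_le_frobn _)).
apply: (le_trans (frobn_factor_err qleN N0 T00 C1 good0 L0_ub Ls_lb iLw projm_weak_strong
    oQw leadQs tau2 dw_gt0)).
have c0 : 0 <= 2 * C * (2 + q%:R) by rewrite mulr_ge0 ?addr_ge0 // mulr_ge0 // ltW.
have -> : fac_cst * u = 2 * C * (2 + q%:R) * ((tau_cst + rho_cst + 1) * u).
  by rewrite /fac_cst mulrA.
rewrite mulrAC [X in _ <= X]mulrC ler_wpM2r ?(ltW sT0) // ler_wpM2l //.
have := rho_leu; have := tau_le; rewrite /u; move: g0; lra.
Qed.

End Oracle.

(** * Probability bounds *)

Section Eventually.
Variable R : realType.

Definition ultimately (Q : nat -> Prop) : Prop := exists n0, forall n, (n0 <= n)%N -> Q n.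

Lemma ev_mono (Q Q' : nat -> Prop) : (forall n, Q n -> Q' n) -> ultimately Q -> ultimately Q'.
Proof. by move=> h [n0 hn]; exists n0 => n /hn/h. Qed.

Lemma ev_and (Q Q' : nat -> Prop) : ultimately Q -> ultimately Q' -> ultimately (fun n => Q n /\ Q' n).
Proof.
move=> [a ha] [b hb]; exists (maxn a b) => n; rewrite geq_max => /andP[an bn].
by split; [exact: ha|exact: hb].
Qed.

Lemma ev_fin (I : finType) (A : {set I}) (Q : I -> nat -> Prop) :
  (forall k, k \in A -> ultimately (Q k)) -> ultimately (fun n => forall k, k \in A -> Q k n).
Proof.
move=> h; have /choice[f hf] (k : I) : exists n0, k \in A -> forall n, (n0 <= n)%N -> Q k n.
  have [kA|] := boolP (k \in A); last by exists 0%N.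
  by have [n0] := h k kA; exists n0.
exists (\max_k f k) => n hn k kA; apply: hf => //.
exact: leq_trans (leq_bigmax _) hn.
Qed.

Lemma fin_bound (I : finType) (A : {set I}) (Q : I -> R -> Prop) :
  (forall k C C', C <= C' -> Q k C -> Q k C') ->
  (forall k, k \in A -> exists C, Q k C) ->
  exists C, forall k, k \in A -> Q k C.
Proof.
move=> mono h; have /choice[f hf] (k : I) : exists C, k \in A -> Q k C.
  have [kA|] := boolP (k \in A); last by exists 0.
  by have [C] := h k kA; exists C.
exists (\big[Num.max/0]_k f k) => k kA; apply: mono (hf k kA).
exact: le_bigmax.
Qed.

Lemma tends0_ev (u : nat -> R) e : tends0 u -> 0 < e -> ultimately (fun n => u n <= e).
Proof.
by move=> h /h; apply: ev_mono => n /ltW; apply: le_trans; exact: ler_norm.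
Qed.

Lemma tends0D (u v : nat -> R) : tends0 u -> tends0 v -> tends0 (fun n => u n + v n).
Proof.
move=> hu hv e e0; have e2 : 0 < e / 2 by rewrite divr_gt0.
apply: ev_mono (ev_and (hu _ e2) (hv _ e2)) => n [h1 h2].
by rewrite (splitr e) (le_lt_trans (ler_normD _ _)) // ltrD.
Qed.

Lemma tends0Z (a : R) (u : nat -> R) : tends0 u -> tends0 (fun n => a * u n).
Proof.
move=> hu e e0; have a1 : 0 < `|a| + 1 by rewrite ltr_wpDl.
have := hu _ (divr_gt0 e0 a1); apply: ev_mono => n; rewrite ltr_pdivlMr // => h.
rewrite normrM; apply: le_lt_trans h; rewrite mulrC ler_wpM2l //; lra.
Qed.

Lemma tends0_le (u v : nat -> R) :
  ultimately (fun n => `|u n| <= v n) -> tends0 v -> tends0 u.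
Proof.
move=> h hv e /hv h2; apply: ev_mono (ev_and h h2) => n [h3]; apply: le_lt_trans.
exact: le_trans h3 (ler_norm _).
Qed.

Lemma nat_infty_ge (T : nat -> nat) (b : R) : nat_to_infty T -> ultimately (fun n => b <= (T n)%:R).
Proof.
move=> /(_ (Num.bound `|b|)); apply: ev_mono => n h.
by rewrite (le_trans (ler_norm b)) ?(le_trans (ltW (archi_boundP (normr_ge0 b)))) // ler_nat.
Qed.

Lemma nat_infty_powR (T : nat -> nat) (a b : R) : 0 < a -> nat_to_infty T ->
  ultimately (fun n => b <= (T n)%:R `^ a).
Proof.
move=> a0 /(nat_infty_ge ((`|b|) `^ a^-1)); apply: ev_mono => n h.
have := ge0_ler_powR (ltW a0) (powR_ge0 _ _) (ler0n _ _) h.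
rewrite -powRrM mulVf ?gt_eqF // powRr1 // => h2.
exact: le_trans (ler_norm _) h2.
Qed.

Lemma tends0_inv (u : nat -> R) :
  (forall b, ultimately (fun n => b <= u n)) -> tends0 (fun n => (u n)^-1).
Proof.
move=> h e e0; have := h (e^-1 + 1); apply: ev_mono => n hn.
have ei : 0 < e^-1 by rewrite invr_gt0.
have un : e^-1 < u n by apply: lt_le_trans hn; rewrite ltrDl.
have u0 : 0 < u n by exact: lt_trans un.
by rewrite gtr0_norm ?invr_gt0 // -[e]invrK ltf_pV2.
Qed.

Lemma nat_infty_sqrt (T : nat -> nat) (b : R) : nat_to_infty T ->
  ultimately (fun n => b <= Num.sqrt (T n)%:R).
Proof.
move=> /(nat_infty_ge (b ^+ 2)); apply: ev_mono => n h.
by apply: le_of_sqr; rewrite ?sqrtr_ge0 // sqr_sqrtr.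
Qed.

Lemma nat_infty_gt0 (T : nat -> nat) : nat_to_infty T -> ultimately (fun n => (0 < T n)%N).
Proof. by move=> /(_ 1%N). Qed.

End Eventually.

(** * Outer probability bounds and the event of a regular sample *)

Section Prob.
Variables (d : measure_display) (Omega : measurableType d) (R : realType).
Variable (P : probability Omega R).

Lemma outer_le_sub (A B : set Omega) (e : R) :
  A `<=` B -> outer_le P B e -> outer_le P A e.
Proof.
by move=> AB [S [mS BS PS]]; exists S; split => //; exact: subset_trans AB BS.
Qed.

Lemma outer_leW (A : set Omega) (e e' : R) : e <= e' -> outer_le P A e -> outer_le P A e'.
Proof.
move=> ee [S [mS BS PS]]; exists S; split => //.
by rewrite (le_trans PS) // lee_fin.
Qed.

Lemma outer_leU (A B : set Omega) (a b : R) :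
  outer_le P A a -> outer_le P B b -> outer_le P (A `|` B) (a + b).
Proof.
move=> [S [mS BS PS]] [S' [mS' BS' PS']]; exists (S `|` S'); split.
- exact: measurableU.
- exact: setUSS.
- by rewrite (le_trans (measureU2 _ _ _)) // EFinD leeD.
Qed.

(** A union bound along an enumeration of the whole type [I], whence the factor [#|I|]. *)
Lemma outer_le_fin (I : finType) (A : {set I}) (X : I -> set Omega) (e : R) : 0 <= e ->
  (forall k, k \in A -> outer_le P (X k) e) ->
  outer_le P [set w | exists2 k, k \in A & X k w] (#|I|%:R * e).
Proof.
move=> e0 h.
have gen (s : seq I) : outer_le P [set w | exists2 k, (k \in s) && (k \in A) & X k w] ((size s)%:R * e).
  elim: s => [|k s IH].
    exists set0; split => //; last by rewrite measure0 mul0r.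
    by move=> w [k]; rewrite in_nil.
  have hk : outer_le P [set w | k \in A /\ X k w] e.
    have [kA|kA] := boolP (k \in A).
      by apply: outer_le_sub (h k kA) => w [].
    exists set0; split => //; last by rewrite measure0 lee_fin.
    by move=> w [].
  rewrite /= -natr1 mulrDl mul1r addrC; apply: outer_le_sub (outer_leU hk IH).
  move=> w [j]; rewrite in_cons => /andP[/orP[/eqP->|js] jA] Xj; first by left.
  by right; exists j => //; rewrite js.
rewrite cardT; apply: outer_le_sub (gen (enum I)) => w [k kA Xk].
by exists k => //; rewrite mem_enum.
Qed.

(** Markov is applied after summation; a union bound over the summands would cost another factor
    [#|I|], which is the growing dimension [N] in the application. *)
Lemma outer_le_markov (I : finType) (f : I -> Omega -> R) (M e : R) :
  (0 < #|I|)%N -> (forall i, measurable_fun setT (f i)) -> (forall i w, 0 <= f i w) ->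
  (forall i, Ebound P (f i) M) -> 0 < M -> 0 < e ->
  outer_le P [set w | #|I|%:R * M / e < \sum_i f i w] e.
Proof.
move=> I0 mf f0 fM M0 e0.
set a := #|I|%:R * M / e.
have a0 : 0 < a by rewrite divr_gt0 // mulr_gt0 // ltr0n.
pose g := fun w => \sum_i f i w.
have mg : measurable_fun setT g by apply: measurable_sum => i; exact: mf.
have g0 w : 0 <= g w by apply: sumr_ge0.
(* The superlevel set with a weak inequality serves as measurable cover, the form in which Markov's
   inequality applies. *)
exists (setT `&` [set w | a <= g w]); split.
- by apply: measurable_fun_le => //; exact: measurable_cst.
- by move=> w /= h; split => //; exact: ltW.
have h := @le_integral_comp_abse _ _ _ P _ measurableT (EFin \o g) a id.
have {}h : (a%:E * P (setT `&` [set w | a%:E <= `|(EFin \o g) w|]) <=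
   \int[P]_(x in setT) `|(EFin \o g) x|)%E.
  apply: h => //; exact/measurable_EFinP.
have e1 : [set w | (a%:E <= `|(EFin \o g) w|)%E] = [set w | a <= g w].
  by apply/seteqP; split => w /=; rewrite ger0_norm // lee_fin.
have e2 : (\int[P]_(x in setT) `|(EFin \o g) x| <= (a * e)%:E)%E.
  have -> : (\int[P]_(x in setT) `|(EFin \o g) x|)%E = (\int[P]_(x in setT) (\sum_i (f i x)%:E))%E.
    apply: eq_integral => x _ /=; rewrite ger0_norm // /g.
    by rewrite sumEFin.
  rewrite ge0_integral_sum //; last 2 first.
  - by move=> i; exact/measurable_EFinP.
  - by move=> i x _; rewrite lee_fin.
  have -> : a * e = \sum_(i : I) M.
    by rewrite /a divfK ?gt_eqF // sumr_const mulr_natl.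
  rewrite -sumEFin; apply: lee_sum => i _; exact: fM.
rewrite e1 in h; have {}h := le_trans h e2.
by rewrite (EFinM a e) lee_pmul2l // in h.
Qed.

Lemma rmx_meas_mulmx m n p (X : Omega -> 'M[R]_(m, n)) (Y : Omega -> 'M[R]_(n, p)) :
  rmx_meas X -> rmx_meas Y -> rmx_meas (fun w => X w *m Y w).
Proof.
move=> mX mY i j; under eq_fun do rewrite mxE.
by apply: measurable_sum => k; exact: measurable_funM.
Qed.

Lemma rmx_meas_trmx m n (X : Omega -> 'M[R]_(m, n)) :
  rmx_meas X -> rmx_meas (fun w => (X w)^T).
Proof. by move=> mX i j; under eq_fun do rewrite mxE; exact: mX. Qed.

Lemma rmx_meas_scale m n (a : R) (X : Omega -> 'M[R]_(m, n)) :
  rmx_meas X -> rmx_meas (fun w => a *: X w).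
Proof.
move=> mX i j; under eq_fun do rewrite mxE.
by apply: measurable_funM => //; exact: measurable_cst.
Qed.

Lemma rmx_meas_col m n (X : Omega -> 'M[R]_(m, n)) j :
  rmx_meas X -> rmx_meas (fun w => col j (X w)).
Proof. by move=> mX i k; under eq_fun do rewrite mxE; exact: mX. Qed.

Lemma rmx_meas_row_mx m n1 n2 (X : Omega -> 'M[R]_(m, n1)) (Y : Omega -> 'M[R]_(m, n2)) :
  rmx_meas X -> rmx_meas Y -> rmx_meas (fun w => row_mx (X w) (Y w)).
Proof.
move=> mX mY i j; under eq_fun do rewrite mxE.
by case: (fintype.split j) => k; [exact: mX|exact: mY].
Qed.

Lemma measurable_frobn_sqr m n (X : Omega -> 'M[R]_(m, n)) :
  rmx_meas X -> measurable_fun setT (fun w => frobn (X w) ^+ 2).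
Proof.
move=> mX; under eq_fun do rewrite frobn_sqr.
apply: measurable_sum => i; apply: measurable_sum => j.
by apply: measurable_funX; exact: mX.
Qed.

(** Three bad events receive [e / 3] each: a factor Gram matrix further from [Sig] than half of its
    coercivity constant [l0], a large noise norm, and a large sum of squared factor-noise products.
    The first one governs both clauses on [F]. *)
Lemma regular_sample_prob r (N T : nat -> nat) (F : forall n, Omega -> 'M[R]_(T n, r))
    (E : forall n, Omega -> 'M[R]_(T n, N n)) (Sig : 'M[R]_r) (M e : R) :
  nat_to_infty N -> nat_to_infty T ->
  (forall n, rmx_meas (F n)) -> (forall n, rmx_meas (E n)) -> 0 < M ->
  cvg_prob0 P (fun n w => frobn ((T n)%:R^-1 *: ((F n w)^T *m F n w) - Sig)) ->
  pd_distinct_eig Sig ->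
  Op P (fun n w => specn (E n w) ^+ 2) (fun n => (maxn (N n) (T n))%:R) ->
  (forall n (i : 'I_(N n)),
      Ebound P (fun w => vnorm ((Num.sqrt (T n)%:R)^-1 *: ((F n w)^T *m col i (E n w))) ^+ 2) M) ->
  0 < e ->
  exists C, ultimately (fun n => outer_le P [set w | ~ regular_sample C (F n w) (E n w)] e).
Proof.
move=> hN hT mF mE M0 cF pd oE eFE e0.
have [l0 l0p hl] := pd_quad pd.
pose l := l0 / 2.
have lp : 0 < l by rewrite divr_gt0.
have e3 : 0 < e / 3 by rewrite divr_gt0.
have [n1 h1] := cF _ _ lp e3.
have [C2 [C2p [n2 h2]]] := oE _ e3.
(* [||F||^2 / T] is the trace of the normalised Gram matrix, that is [\tr Sig] plus the trace of a
   deviation of norm at most [l]. *)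
pose C1 := `|\tr Sig| + (1 + r%:R) * l.
have C1p : 0 <= C1 by rewrite addr_ge0 // mulr_ge0 ?addr_ge0 // ltW.
pose C3 := M / (e / 3).
have C3p : 0 <= C3 by rewrite divr_ge0 // ltW.
have li : 0 < l^-1 by rewrite invr_gt0.
have aux (a b c x : R) : 0 <= a -> 0 < b -> 0 < c -> 0 <= x ->
    [/\ a <= a + b + c + x, b <= a + b + c + x, c <= a + b + c + x & x <= a + b + c + x].
  by move=> *; split; lra.
have {aux} := aux _ _ _ _ C1p li C2p C3p.
set CC := C1 + _ + _ + _ => -[b1 b2 b3 b4]; exists CC.
have h1' : ultimately (fun n => outer_le P [set w | l < frobn ((T n)%:R^-1 *: ((F n w)^T *m F n w) - Sig)] (e / 3)) by exists n1.
have h2' : ultimately (fun n => outer_le P [set w | C2 * (maxn (N n) (T n))%:R < specn (E n w) ^+ 2] (e / 3)) by exists n2.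
apply: ev_mono (ev_and (ev_and h1' h2') (ev_and (nat_infty_gt0 hN) (nat_infty_gt0 hT))).
move=> n [[{}h1 {}h2] [N0 T0]].
have Tp : 0 < (T n)%:R :> R by rewrite ltr0n.
pose f (i : 'I_(N n)) w := vnorm ((Num.sqrt (T n)%:R)^-1 *: ((F n w)^T *m col i (E n w))) ^+ 2.
have h3 : outer_le P [set w | #|'I_(N n)|%:R * M / (e / 3) < \sum_i f i w] (e / 3).
  apply: outer_le_markov => //; first by rewrite card_ord.
  - move=> i; rewrite /f; under eq_fun do rewrite vnormE.
    apply: measurable_frobn_sqr; apply: rmx_meas_scale; apply: rmx_meas_mulmx.
      exact: rmx_meas_trmx.
    exact: rmx_meas_col.
  - by move=> i w; exact: sqr_ge0.
  - by move=> i; exact: eFE.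
apply: (@outer_leW _ (e / 3 + e / 3 + e / 3)); first lra.
apply: outer_le_sub (outer_leU (outer_leU h1 h2) h3) => w /=.
apply: contra_notP; rewrite !not_orP => -[[/negP k1 /negP k2] /negP k3].
rewrite -!leNgt in k1 k2 k3.
apply: regular_sample_le (lexx _) _; split.
- have -> : frobn (F n w) ^+ 2 = (T n)%:R * \tr ((T n)%:R^-1 *: ((F n w)^T *m F n w)).
    by rewrite mxtraceZ mulrA mulfV ?mul1r ?gt_eqF // frobn_sqr_tr.
  rewrite mulrC ler_wpM2r //; apply: (@le_trans _ _ C1) => //.
  have -> : (T n)%:R^-1 *: ((F n w)^T *m F n w) =
    Sig + ((T n)%:R^-1 *: ((F n w)^T *m F n w) - Sig) by rewrite addrC subrK.
  rewrite mxtraceD lerD ?ler_norm //; apply: (le_trans (mxtrace_le_frobn _)).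
  by rewrite ler_wpM2l // addr_ge0.
- move=> z; have hl2 (y : 'cV[R]_r) : 2 * l * frobn y ^+ 2 <= \tr (y^T *m (Sig *m y)).
    by have := hl y; rewrite /l; lra.
  have /(_ z) := gram_lb hl2 (opb_le k1 (@opb_frobn _ _ _ _)).
  rewrite mulrC ler_pdivlMl // mulrA -ler_pdivlMr // => h4.
  apply: (le_trans h4); rewrite mulrC ler_wpM2r ?sqr_ge0 //.
- by apply: (le_trans k2); rewrite ler_wpM2r.
have FE : frobn ((F n w)^T *m E n w) ^+ 2 = (T n)%:R * \sum_i f i w.
  rewrite frobn_sqr_col mulr_sumr; apply: eq_bigr => i _.
  rewrite /f vnormE frobnZ exprMn ger0_norm ?invr_ge0 ?sqrtr_ge0 // exprVn (sqr_sqrtr (ler0n R (T n))).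
  by rewrite mulVKf ?gt_eqF // !colE mulmxA.
rewrite FE; rewrite card_ord in k3.
apply: (@le_trans _ _ (C3 * ((N n)%:R * (T n)%:R))).
  rewrite mulrA mulrC ler_wpM2r // (le_trans k3) // /C3; lra.
by rewrite ler_wpM2r ?mulr_ge0.
Qed.

End Prob.

(** * Upper and lower bounds for the loading matrices *)

Section Loadings.
Variable R : realType.

Lemma frobn_maxnorm m n (B : 'M[R]_(m, n)) (M : R) : maxnorm B <= M ->
  frobn B ^+ 2 <= n%:R * M ^+ 2 * m%:R.
Proof.
move=> h; rewrite frobn_sqr.
have entry i j : B i j ^+ 2 <= M ^+ 2.
  rewrite -[B i j ^+ 2]real_normK ?num_real // ler_pXn2r ?nnegrE //.
    apply: le_trans h; rewrite /maxnorm.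
    exact: le_trans (le_bigmax _ (fun j => `|B i j|) j)
      (le_bigmax _ (fun i => \big[Num.max/0]_j `|B i j|) i).
  exact: le_trans (le_trans (normr_ge0 _) (le_bigmax _ (fun j => `|B i j|) j))
      (le_trans (le_bigmax _ (fun i => \big[Num.max/0]_j `|B i j|) i) h).
apply: (@le_trans _ _ (\sum_(i < m) \sum_(j < n) M ^+ 2)).
  by apply: ler_sum => i _; apply: ler_sum => j _.
by rewrite !sumr_const !card_ord -[X in X <= _]mulr_natr -[M ^+ 2 *+ n]mulr_natl.
Qed.

(** In the variable [D^(1/2) z] the hypothesis puts a Gram matrix within [1/2] of the identity.
    Keeping the weights inside the sum allows the strong columns to be read at scale [N] and all
    columns at scale [N^alpha_s]. *)
Lemma weighted_gram_lb m n (L : 'M[R]_(m, n)) (d : 'I_n -> R) :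
  (forall j, 0 < d j) ->
  specn (diagv (fun j => (Num.sqrt (d j))^-1) *m (L^T *m L) *m
    diagv (fun j => (Num.sqrt (d j))^-1) - 1%:M) <= 2^-1 ->
  forall z : 'cV[R]_n, \sum_j d j * z j 0 ^+ 2 <= 2 * frobn (L *m z) ^+ 2.
Proof.
move=> d0 h z; set D := diagv _ in h.
pose y := diagv (fun j => Num.sqrt (d j)) *m z.
have Dy : D *m y = z.
  rewrite /y mulmxA; have -> : D *m diagv (fun j => Num.sqrt (d j)) = 1%:M.
    apply/matrixP => i j; rewrite mul_mx_diag !mxE.
    have [->|_] := eqVneq i j; last by rewrite mulr0n mul0r.
    by rewrite mulr1n mulVf // gt_eqF // sqrtr_gt0.
  by rewrite mul1mx.
have yE : frobn y ^+ 2 = \sum_j d j * z j 0 ^+ 2.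
  rewrite frobn_sqr; apply: eq_bigr => j _.
  by rewrite big_ord1 /y mul_diag_mx !mxE exprMn sqr_sqrtr // ltW.
have DT : D^T = D by rewrite /D /diagv tr_diag_mx.
have G : D *m (L^T *m L) *m D = 1 *: ((L *m D)^T *m (L *m D)).
  by rewrite scale1r trmx_mul DT !mulmxA.
rewrite G in h.
have h1 (x : 'cV[R]_n) : 2 * 2^-1 * frobn x ^+ 2 <= \tr (x^T *m (1%:M *m x)).
  by rewrite mulfV // mul1r mul1mx frobn_sqr_tr.
have := gram_lb h1 (opb_le h (@opb_specn _ _ _ _)) y.
by rewrite -mulmxA Dy yE mul1r ler_pdivrMl.
Qed.

Lemma scaled_gram_lb m n (L : 'M[R]_(m, n)) (a : R) : 0 < a ->
  specn (a^-1 *: (L^T *m L) - 1%:M) <= 2^-1 ->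
  forall z : 'cV[R]_n, a * frobn z ^+ 2 <= 2 * frobn (L *m z) ^+ 2.
Proof.
move=> a0 h z.
have h1 (x : 'cV[R]_n) : 2 * 2^-1 * frobn x ^+ 2 <= \tr (x^T *m (1%:M *m x)).
  by rewrite mulfV // mul1r mul1mx frobn_sqr_tr.
have := gram_lb h1 (opb_le h (@opb_specn _ _ _ _)) z.
rewrite ler_pdivlMl // mulrCA; lra.
Qed.

End Loadings.

(** * Comparison of the working rate with the stated one *)

Section Rates.
Variable R : realType.

(** Replacing [Tt] by the smaller [T0] produces [N / (sqrt T0 nu)], which is assumed to vanish, and
    other terms that vanish as well. *)
Lemma weak_rate_le (K : nat) (A : {set 'I_K}) (N T0 : nat) (Tk : 'I_K -> nat) (nu eps : R) :
  (0 < N)%N -> (0 < T0)%N -> 0 < nu -> 0 <= eps ->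
  weak_rate A N T0 Tk nu eps <=
    N%:R / (Num.sqrt T0%:R * nu) + nu^-1 + (Num.sqrt T0%:R)^-1 + (Num.sqrt N%:R)^-1 + eps.
Proof.
move=> N0 T00 nu0 eps0; rewrite /weak_rate; set Tt := (T0 + _)%N.
have sT0 : 0 < Num.sqrt T0%:R :> R by rewrite sqrtr_gt0 ltr0n.
have sN0 : 0 < Num.sqrt N%:R :> R by rewrite sqrtr_gt0 ltr0n.
have TT : T0%:R <= Tt%:R :> R by rewrite ler_nat leq_addr.
have T0p : 0 < T0%:R :> R by rewrite ltr0n.
have Ttp : 0 < Tt%:R :> R by exact: lt_le_trans TT.
have e1 : Num.sqrt T0%:R * N%:R / (Tt%:R * nu) <= N%:R / (Num.sqrt T0%:R * nu).
  rewrite ler_pdivrMr ?mulr_gt0 //.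
  have -> : N%:R / (Num.sqrt T0%:R * nu) * (Tt%:R * nu) =
      N%:R * (Num.sqrt T0%:R)^-1 * Tt%:R by field; rewrite !gt_eqF.
  rewrite mulrC -mulrA ler_wpM2l // mulrC ler_pdivlMr //.
  by rewrite -expr2 (sqr_sqrtr (ler0n R T0)).
have e2 : T0%:R / (Tt%:R * nu) <= nu^-1.
  by rewrite invfM mulrA ler_piMl ?invr_ge0 ?(ltW nu0) // ler_pdivrMr // mul1r.
have e3 : (Num.sqrt Tt%:R)^-1 <= (Num.sqrt T0%:R)^-1 :> R.
  by rewrite lef_pV2 ?posrE ?sqrtr_gt0 // ler_sqrt.
have e4 : (N%:R)^-1 <= (Num.sqrt N%:R)^-1 :> R.
  rewrite lef_pV2 ?posrE ?ltr0n // -{2}(sqr_sqrtr (ler0n R N)) expr2 ler_peMr ?(ltW sN0) //.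
  exact: sqrt_nat_ge1.
by rewrite !lerD.
Qed.

(** Converts a limit of [x] into a smallness condition on its square: [b * x <= 1] and
    [x <= b^-1 <= 1]. *)
Lemma mul_sqr_le1 (b x : R) : 1 <= b -> 0 <= x -> x <= b^-1 -> b * x ^+ 2 <= 1.
Proof.
move=> b1 x0 xb; have b0 : 0 < b by exact: lt_le_trans ltr01 b1.
have bx : b * x <= 1 by rewrite mulrC -ler_pdivlMr ?mul1r.
rewrite expr2 mulrA mulr_ile1 // ?mulr_ge0 ?(ltW b0) //.
by rewrite (le_trans xb) // invf_le1.
Qed.

(** In the first term the factors [sqrt N] cancel, leaving [weak_rate] times
    [sqrt (N^a1 / N^as_) >= 1]; the last term is [N^-1/2] times the same ratio. *)
Lemma thm2_rate_ge (K : nat) (A : {set 'I_K}) (N T0 : nat) (Tk : 'I_K -> nat) (a1 as_ eps : R) :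
  (0 < N)%N -> as_ <= a1 -> 0 <= eps ->
  weak_rate A N T0 Tk (N%:R `^ as_) eps + (Num.sqrt T0%:R)^-1 + (Num.sqrt N%:R)^-1 <=
  thm2_rate N T0 (T0 + \sum_(k in A) Tk k)%N a1 as_ eps.
Proof.
move=> N0 le_a eps0; have Np : 0 < N%:R :> R by rewrite ltr0n.
have nup a : 0 < N%:R `^ a :> R by exact: powR_gt0.
have sp a : 0 < Num.sqrt (N%:R `^ a) :> R by rewrite sqrtr_gt0.
have sN : 0 < Num.sqrt N%:R :> R by rewrite sqrtr_gt0.
have ratio : 1 <= Num.sqrt (N%:R `^ a1) / Num.sqrt (N%:R `^ as_) :> R.
  by rewrite ler_pdivlMr // mul1r ler_sqrt // ler_powR // ler1n.
have g0 : 0 <= weak_rate A N T0 Tk (N%:R `^ as_) eps.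
  by rewrite /weak_rate !addr_ge0 ?divr_ge0 ?mulr_ge0 ?invr_ge0 ?sqrtr_ge0 ?powR_ge0.
rewrite /thm2_rate; apply: lerD; first apply: lerD => //.
  rewrite /delta_rate -/(weak_rate A N T0 Tk (N%:R `^ as_) eps).
  set g := weak_rate _ _ _ _ _ _ in g0 *.
  have -> : Num.sqrt N%:R / Num.sqrt (N%:R `^ as_) * (Num.sqrt (N%:R `^ a1) / Num.sqrt N%:R * g) =
     Num.sqrt (N%:R `^ a1) / Num.sqrt (N%:R `^ as_) * g by field; rewrite !gt_eqF.
  by rewrite ler_peMl.
have -> : N%:R `^ (1 + as_) = N%:R * N%:R `^ as_ :> R.
  by rewrite powRD ?powRr1 // [N%:R == 0]gt_eqF // implybT.
rewrite sqrtrM // invfM mulrCA.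
by rewrite ler_peMr // invr_ge0 sqrtr_ge0.
Qed.

End Rates.

(* Asymptotic index n: all dimensions/objects indexed by n; N n -> oo and
   T_k n -> oo.  Target: q strong + s'.+1 weak factors (r_0 = q + s'.+1).
   Sources k : 'I_K with r k factors; A = informative set. *)
Theorem theorem2
  (R : realType) (d : measure_display) (Omega : measurableType d)
  (P : probability Omega R)
  (q s' K : nat) (A : {set 'I_K}) (r : 'I_K -> nat)
  (alpha : 'I_s'.+1 -> R) (M kappa : R) (eps : nat -> R)
  (N T0 : nat -> nat) (Tk : nat -> 'I_K -> nat)
  (* loadings *)
  (Ls : forall n, 'M[R]_(N n, q)) (Lw : forall n, 'M[R]_(N n, s'.+1))
  (Lk : forall n (k : 'I_K), 'M[R]_(N n, r k))
  (Tset : forall (n : nat) (k : 'I_K), {set 'I_(r k)})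
  (ds : nat -> 'I_q -> R) (dw : nat -> 'I_s'.+1 -> R)
  (* factors and errors *)
  (Fs : forall n, Omega -> 'M[R]_(T0 n, q))
  (Fw : forall n, Omega -> 'M[R]_(T0 n, s'.+1))
  (E0 : forall n, Omega -> 'M[R]_(T0 n, N n))
  (Fk : forall n (k : 'I_K), Omega -> 'M[R]_(Tk n k, r k))
  (Ek : forall n (k : 'I_K), Omega -> 'M[R]_(Tk n k, N n))
  (Sig0 : 'M[R]_(q + s'.+1)) (Sigk : forall k : 'I_K, 'M[R]_(r k))
  (* oracle TransPCA estimators *)
  (Q0hat : forall n, Omega -> 'M[R]_(N n, q + s'.+1))
  (Qkhat : forall n (k : 'I_K), Omega -> 'M[R]_(N n, r k))
  (Qwhat : forall n, Omega -> 'M[R]_(N n, s'.+1))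
  (Qshat : forall n, Omega -> 'M[R]_(N n, q)) :
  let Ttot n := (T0 n + \sum_(k in A) Tk n k)%N in
  let L0 n := row_mx (Ls n) (Lw n) in
  let F0 n w := row_mx (Fs n w) (Fw n w) in
  let X0 n w := F0 n w *m (L0 n)^T + E0 n w in
  let Xk n k w := Fk n k w *m (Lk n k)^T + Ek n k w in
  let Dmh n := diagv (fun j : 'I_(q + s'.+1) =>
                 (Num.sqrt (row_mx (\row_i ds n i) (\row_i dw n i) 0 j))^-1) in
  let a1 := alpha ord0 in
  let as_ := alpha ord_max in
  (* regime *)
  nat_to_infty N -> nat_to_infty T0 ->
  (forall k, k \in A -> nat_to_infty (fun n => Tk n k)) ->
  (* measurability of the random matrices *)
  (forall n, rmx_meas (Fs n)) -> (forall n, rmx_meas (Fw n)) ->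
  (forall n, rmx_meas (E0 n)) ->
  (forall n k, rmx_meas (Fk n k)) -> (forall n k, rmx_meas (Ek n k)) ->
  0 < M ->
  (* (A1) *)
  (forall n (t : 'I_(T0 n)), Ebound P (fun w => rvnorm (row t (F0 n w)) ^+ 4) M) ->
  (forall n k (t : 'I_(Tk n k)),
      Ebound P (fun w => rvnorm (row t (Fk n k w)) ^+ 4) M) ->
  cvg_prob0 P (fun n w => frobn ((T0 n)%:R^-1 *: ((F0 n w)^T *m F0 n w) - Sig0)) ->
  pd_distinct_eig Sig0 ->
  (forall k, cvg_prob0 P (fun n w =>
      frobn ((Tk n k)%:R^-1 *: ((Fk n k w)^T *m Fk n k w) - Sigk k))) ->
  (forall k, pd_distinct_eig (Sigk k)) ->
  (* (A2) *)
  (forall n, maxnorm (L0 n) <= M) -> (forall n k, maxnorm (Lk n k) <= M) ->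
  tends0 (fun n => specn (Dmh n *m ((L0 n)^T *m L0 n) *m Dmh n - 1%:M)) ->
  (exists c C : R, [/\ 0 < c, c <= C,
     (forall n i, c * (N n)%:R <= ds n i <= C * (N n)%:R) &
     (forall n i, c * ((N n)%:R `^ alpha i) <= dw n i <= C * ((N n)%:R `^ alpha i))]) ->
  0 < as_ -> (forall i j : 'I_s'.+1, (i <= j)%N -> alpha j <= alpha i) -> a1 < 1 ->
  (forall k, tends0 (fun n => specn ((N n)%:R^-1 *: ((Lk n k)^T *m Lk n k) - 1%:M))) ->
  (* (A3) *)
  Op P (fun n w => specn (E0 n w) ^+ 2) (fun n => (maxn (N n) (T0 n))%:R) ->
  (forall k, Op P (fun n w => specn (Ek n k w) ^+ 2) (fun n => (maxn (N n) (Tk n k))%:R)) ->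
  (* (A4) *)
  (forall n (t : 'I_(T0 n)),
      Ebound P (fun w => rvnorm (row t (E0 n w) *m L0 n *m Dmh n) ^+ 2) M) ->
  (forall n k (t : 'I_(Tk n k)),
      Ebound P (fun w => rvnorm ((Num.sqrt (N n)%:R)^-1 *: (row t (Ek n k w) *m Lk n k)) ^+ 2) M) ->
  (forall n (i : 'I_(N n)),
      Ebound P (fun w => vnorm ((Num.sqrt (T0 n)%:R)^-1 *: ((F0 n w)^T *m col i (E0 n w))) ^+ 2) M) ->
  (forall n k (i : 'I_(N n)),
      Ebound P (fun w => vnorm ((Num.sqrt (Tk n k)%:R)^-1 *: ((Fk n k w)^T *m col i (Ek n k w))) ^+ 2) M) ->
  (* column splits *)
  (forall n, projm (L0 n) = projm (Lw n) + projm (Ls n)) ->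
  (forall n k, k \in A -> #|Tset n k| = s'.+1) ->
  (forall n k, k \in A -> projm (Lk n k) =
      projm (colsel (Lk n k) (Tset n k)) + projm (colsel (Lk n k) (~: Tset n k))) ->
  (* (A5) *)
  (forall n k, k \in A -> frobn (projm (colsel (Lk n k) (Tset n k)) - projm (Lw n)) <= eps n) ->
  0 < kappa ->
  (forall n, (Ttot n)%:R^-1 * specn ((T0 n)%:R *: projm (Ls n)
       + \sum_(k in A) (Tk n k)%:R *: projm (colsel (Lk n k) (~: Tset n k))) <= 1 - kappa) ->
  (* (A6) *)
  tends0 (fun n => (N n)%:R / (Num.sqrt (T0 n)%:R * ((N n)%:R `^ as_))) ->
  tends0 (fun n => (T0 n)%:R * Num.sqrt (N n)%:R
                   / ((Ttot n)%:R * Num.sqrt ((N n)%:R `^ as_))) ->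
  (* eps = o(1 / sqrt(N^(1 - alpha_s))) *)
  tends0 (fun n => eps n * Num.sqrt ((N n)%:R `^ (1 - as_))) ->
  (* oracle TransPCA *)
  (forall n w, leading_eigvecs
      (((N n * T0 n)%N)%:R^-1 *: ((X0 n w)^T *m X0 n w)) (Q0hat n w)) ->
  (forall n k w, k \in A -> leading_eigvecs
      (((N n * Tk n k)%N)%:R^-1 *: ((Xk n k w)^T *m Xk n k w)) (Qkhat n k w)) ->
  (forall n w, leading_eigvecs
      ((Ttot n)%:R^-1 *: ((T0 n)%:R *: (Q0hat n w *m (Q0hat n w)^T)
         + \sum_(k in A) (Tk n k)%:R *: (Qkhat n k w *m (Qkhat n k w)^T)))
      (Qwhat n w)) ->
  (forall n w, leading_eigvecs (strong_mat (X0 n w) (Qwhat n w)) (Qshat n w)) ->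
  (* conclusion *)
  exists H : forall n, Omega -> 'M[R]_q,
    [/\ (forall n w, H n w \in unitmx),
        Op P (fun n w => (Num.sqrt (N n)%:R)^-1 *
                specn (Ls_hat (Qshat n w) - Ls n *m H n w))
           (fun n => thm2_rate (N n) (T0 n) (Ttot n) a1 as_ (eps n)) &
        Op P (fun n w => (Num.sqrt (T0 n)%:R)^-1 *
                specn (Fs_hat (X0 n w) (Qwhat n w) (dw n) (Qshat n w)
                       - Fs n w *m invmx (H n w)^T))
           (fun n => thm2_rate (N n) (T0 n) (Ttot n) a1 as_ (eps n))].
Proof.
move=> Ttot L0 F0 X0 Xk Dmh a1 as_ hN hT0 hTk mFs mFw mE0 mFk mEk M0.
move=> _ _ cF0 pd0 cFk pdk mx0 mxk A2 [c [C [c0 cC hds hdw]]] as0 mono a1lt A2k.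
move=> oE0 oEk _ _ eF0 eFk split0 _ splitk closek kappa0 gap A61 A62 epso.
move=> leadQ0 leadQk leadQw leadQs.
have as_le1 : as_ <= a1 by apply: mono; rewrite leq_ord.
have ev_N := nat_infty_gt0 hN.
have Nge1 n : (0 < N n)%N -> 1 <= (N n)%:R :> R by rewrite ler1n.
(* (A6)(2) forces [A] to be nonempty: otherwise T = T_0 and its ratio is at least 1. *)
have [k0 k0A] : exists k, k \in A.
  apply/set0Pn/eqP => A0.
  have [n [h [Nn T0n]]] : exists n, `|(T0 n)%:R * Num.sqrt (N n)%:R
                   / ((Ttot n)%:R * Num.sqrt ((N n)%:R `^ as_))| < 1 /\ (0 < N n)%N /\ (0 < T0 n)%N.
    have [n0 hn] := ev_and (A62 _ ltr01) (ev_and ev_N (nat_infty_gt0 hT0)).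
    by exists n0; apply: hn.
  move: h; rewrite /Ttot A0 big_set0 addn0.
  have Np : 0 < (N n)%:R :> R by rewrite ltr0n.
  have Tp : 0 < (T0 n)%:R :> R by rewrite ltr0n.
  have sp : 0 < Num.sqrt ((N n)%:R `^ as_) :> R by rewrite sqrtr_gt0 powR_gt0.
  rewrite ger0_norm ?divr_ge0 ?mulr_ge0 ?sqrtr_ge0 //.
  rewrite ltr_pdivrMr ?mulr_gt0 // mul1r ltr_pM2l // ltr_sqrt ?powR_gt0 // ltNge => /negP; apply.
  have := ler_powR (Nge1 n Nn) (le_trans as_le1 (ltW a1lt)).
  by rewrite powRr1.
(* A nonempty [A] supplies a norm bounded by [eps n]. *)
have eps0 n : 0 <= eps n by apply: le_trans (closek n k0 k0A).
pose nu n : R := (N n)%:R `^ as_.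
have evnu b : ultimately (fun n => b <= nu n) by exact: nat_infty_powR.
have teps : tends0 eps.
  apply: tends0_le epso; apply: ev_mono ev_N => n Nn.
  rewrite ger0_norm // ler_peMr //.
  rewrite -[X in X <= _]sqrtr1 -[X in Num.sqrt X <= _](powRr0 (N n)%:R).
  by rewrite ler_sqrt ?powR_gt0 ?ltr0n // ler_powR ?Nge1 // subr_ge0 (le_trans as_le1) // ltW.
pose u n : R := weak_rate A (N n) (T0 n) (Tk n) (nu n) (eps n)
  + (Num.sqrt (T0 n)%:R)^-1 + (Num.sqrt (N n)%:R)^-1.
have tsN : tends0 (fun n => (Num.sqrt (N n)%:R)^-1 : R).
  by apply: tends0_inv => b; exact: nat_infty_sqrt.
have tsT : tends0 (fun n => (Num.sqrt (T0 n)%:R)^-1 : R).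
  by apply: tends0_inv => b; exact: nat_infty_sqrt.
have tu : tends0 u.
  have t := tends0D (tends0D (tends0D (tends0D A61 (tends0_inv evnu)) (tends0D tsT tsN)) teps)
    (tends0D tsT tsN).
  apply: tends0_le t; apply: ev_mono (ev_and ev_N (nat_infty_gt0 hT0)) => n [Nn Tn].
  have nup : 0 < nu n by rewrite powR_gt0 // ltr0n.
  have w := weak_rate_le A (Tk n) Nn Tn nup (eps0 n).
  rewrite ger0_norm.
    by rewrite /u; move: w; rewrite -/(nu n); lra.
  by rewrite /u /weak_rate !addr_ge0 ?divr_ge0 ?mulr_ge0 ?invr_ge0 ?sqrtr_ge0 // ltW.
(* Invertibility is required at every [w]; where [rotation] is singular, which eventually has small
   outer probability, the identity stands in. *)
exists (fun n w => if rotation (Ls n) (Qshat n w) \in unitmx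
  then rotation (Ls n) (Qshat n w) else 1%:M).
have main (e : R) : 0 < e -> exists C' : R, 0 < C' /\ ultimately (fun n =>
    outer_le P [set w | ~ [/\ rotation (Ls n) (Qshat n w) \in unitmx,
      (Num.sqrt (N n)%:R)^-1 * specn (Ls_hat (Qshat n w) - Ls n *m rotation (Ls n) (Qshat n w)) <=
        C' * thm2_rate (N n) (T0 n) (Ttot n) a1 as_ (eps n) &
      (Num.sqrt (T0 n)%:R)^-1 * specn (Fs_hat (X0 n w) (Qwhat n w) (dw n) (Qshat n w)
         - Fs n w *m invmx (rotation (Ls n) (Qshat n w))^T) <=
        C' * thm2_rate (N n) (T0 n) (Ttot n) a1 as_ (eps n)]] e).
  move=> e0.
  have mF0 n : rmx_meas (F0 n) by exact: rmx_meas_row_mx.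
  have [Ca hCa] := regular_sample_prob hN hT0 mF0 mE0 M0 cF0 pd0 oE0 eF0 (divr_gt0 e0 (ltr0n _ 2)).
  (* Half of [e] goes to the target and half to the union over the sources; the [+ 1] keeps the
     division safe for every [K]. *)
  pose ek := e / 2 / (K%:R + 1).
  have K1 : 0 < K%:R + 1 :> R by rewrite ltr_wpDl.
  have ek0 : 0 < ek by rewrite !divr_gt0.
  have [Cb hCb] : exists Cb, forall k, k \in A ->
      ultimately (fun n => outer_le P [set w | ~ regular_sample Cb (Fk n k w) (Ek n k w)] ek).
    apply: fin_bound.
      move=> k x y xy; apply: ev_mono => n; apply: outer_le_sub => w.
      by apply: contra_not; exact: regular_sample_le.
    move=> k kA; exact: (regular_sample_prob hN (hTk k kA) (mFk^~ k) (mEk^~ k) M0 (cFk k) (pdk k)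
      (oEk k) (eFk^~ k) ek0).
  (* [rr] exceeds every rank in use, so [rr M^2] bounds the squared loading norms per unit of [N].
     In [CC], the summands [2 / c] and [2] come from the Gram lower bounds of the target and of the
     sources. *)
  pose rr := (q + s'.+1 + \sum_(k in A) r k)%N.
  pose CC : R := 1 + `|Ca| + `|Cb| + rr%:R * M ^+ 2 + 2 / c + 2.
  have ci : 0 < c^-1 by rewrite invr_gt0.
  have rM : 0 <= rr%:R * M ^+ 2 :> R by rewrite mulr_ge0 ?sqr_ge0.
  have Ca0 := normr_ge0 Ca; have Cb0 := normr_ge0 Cb.
  have [CC1 CCa CCb CCr [CCc CC2 CCp]] : [/\ 1 <= CC, Ca <= CC, Cb <= CC,
      rr%:R * M ^+ 2 <= CC & [/\ 2 / c <= CC, 2 <= CC & 0 < CC]].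
    move: ci rM Ca0 Cb0 (ler_norm Ca) (ler_norm Cb); rewrite /CC; clear.
    by move: `|Ca| `|Cb| (rr%:R * M ^+ 2) c^-1 => a b x y *; do ?split; lra.
  clearbody CC.
  pose wc := weak_cst q s'.+1 A r CC.
  pose rc := rho_cst q s'.+1 A r CC kappa.
  pose tc := tau_cst q s'.+1 A r CC kappa.
  pose fc := fac_cst q s'.+1 A r CC kappa.
  exists (`|tc| + `|fc| + 1); split; first by rewrite ltr_wpDl ?addr_ge0.
  have half : 0 < 2^-1 :> R by rewrite invr_gt0.
  have C8 : 0 < (8 * CC ^+ 2)^-1 by rewrite invr_gt0 mulr_gt0 ?exprn_gt0.
  have C3 : 0 < (4 * CC ^+ 3)^-1 by rewrite invr_gt0 mulr_gt0 ?exprn_gt0.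
  have E1 := ev_and ev_N (nat_infty_gt0 hT0).
  have E2 := ev_fin (fun k kA => nat_infty_gt0 (hTk k kA)).
  have E3 := ev_and (hN (q + s'.+1)%N) (ev_fin (fun k (kA : k \in A) => hN (r k))).
  have E4 := ev_and (tends0_ev A61 C3) (evnu (4 * CC ^+ 3)).
  have E5 := ev_and (nat_infty_ge (16 * CC ^+ 3) hN) (nat_infty_ge (16 * CC ^+ 3) hT0).
  have E6 := ev_fin (fun k kA => nat_infty_ge (16 * CC ^+ 3) (hTk k kA)).
  have E7 := ev_and (tends0_ev (tends0Z wc tu) (divr_gt0 kappa0 (ltr0n _ 2)))
     (ev_and (tends0_ev (tends0Z rc tu) C8) (tends0_ev (tends0Z tc tu) half)).
  have E8 := ev_and (tends0_ev A2 half) (ev_fin (fun k (kA : k \in A) => tends0_ev (A2k k) half)).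
  have E9 := ev_and hCa (ev_fin hCb).
  apply: ev_mono (ev_and (ev_and (ev_and E1 E2) (ev_and E3 E4))
    (ev_and (ev_and (ev_and E5 E6) E7) (ev_and E8 E9))).
  move=> n [[[[Nn Tn] Tkn] [[qsN rN] [s1 s2]]] [[[[n16 t16] tk16] [u1 [u2 u3]]] [[g1 gk] [p1 pk]]]].
  have pk' := outer_le_fin (ltW ek0) pk.
  have tot : e / 2 + #|'I_K|%:R * ek <= e.
    rewrite card_ord /ek mulrCA [leRHS]splitr lerD2l ger_pMr ?divr_gt0 //.
    by rewrite ler_pdivrMr // mul1r lerDl.
  apply: outer_leW tot _; apply: outer_le_sub (outer_leU p1 pk') => w /= .
  apply: contra_notP => /not_orP[/contrapT good0 nk].
  have {}good0 := regular_sample_le CCa good0.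
  have goodk k : k \in A -> regular_sample CC (Fk n k w) (Ek n k w).
    move=> kA; apply: regular_sample_le CCb _; apply: contrapT => h.
    by apply: nk; exists k.
  have Np : 0 < (N n)%:R :> R by rewrite ltr0n.
  have Tp : 0 < (T0 n)%:R :> R by rewrite ltr0n.
  have nup : 0 < nu n by rewrite powR_gt0.
  have CC30 : 0 <= CC ^+ 3 by rewrite exprn_ge0 // ltW.
  have nuN (a : R) : a <= 1 -> (N n)%:R `^ a <= (N n)%:R.
    by move=> h; have := ler_powR (Nge1 n Nn) h; rewrite powRr1.
  have as1 : as_ <= 1 by rewrite (le_trans as_le1) // ltW.
  have hmax (b : R) (x y : nat) : b <= x%:R -> b <= y%:R -> b * (maxn x y)%:R <= y%:R * x%:R :> R.
    by move=> bx By; case: (leqP x y) => _; [rewrite mulrC ler_wpM2l|rewrite ler_wpM2r].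
  have four (k3 : R) : (16 * CC ^+ 3 <= k3) -> 4 * CC ^+ 3 <= k3.
    by apply: le_trans; rewrite ler_wpM2r // ler_nat.
  (* For [N <= T0] the growth of [nu] suffices; otherwise the vanishing ratio [N / (sqrt T0 nu)] is
     used with [sqrt T0 <= T0]. *)
  have small0 : 4 * CC ^+ 3 * (maxn (N n) (T0 n))%:R <= (T0 n)%:R * nu n.
    case: (leqP (N n) (T0 n)) => _; first by rewrite mulrC ler_wpM2l.
    move: s1; rewrite ler_pdivrMr ?mulr_gt0 ?sqrtr_gt0 // ler_pdivlMl ?mulr_gt0 ?exprn_gt0 //.
    move=> h; apply: (le_trans h); rewrite -/(nu n) ler_wpM2r ?(ltW nup) //.
    rewrite -[X in _ <= X](sqr_sqrtr (ler0n R (T0 n))) expr2 ler_peMr ?sqrtr_ge0 //.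
    exact: sqrt_nat_ge1.
  have smallk k : k \in A -> 4 * CC ^+ 3 * (maxn (N n) (Tk n k))%:R <= (Tk n k)%:R * (N n)%:R.
    by move=> kA; apply: hmax; apply: four => //; exact: tk16.
  have strong16 : 16 * CC ^+ 3 * (maxn (N n) (T0 n))%:R <= (T0 n)%:R * (N n)%:R by apply: hmax.
  have ubL m x (B : 'M[R]_(m, x)) : maxnorm B <= M -> (x <= rr)%N -> frobn B ^+ 2 <= CC * m%:R.
    move=> hB hx; apply: (le_trans (frobn_maxnorm hB)); rewrite ler_wpM2r //.
    by apply: le_trans CCr; rewrite ler_wpM2r ?sqr_ge0 // ler_nat.
  have L0_ub := ubL _ _ _ (mx0 n) (leq_addr _ _).
  have Lk_ub k : k \in A -> frobn (Lk n k) ^+ 2 <= CC * (N n)%:R.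
    move=> kA; apply: ubL => //; rewrite /rr (bigD1 k) //=.
    by rewrite addnCA leq_addr.
  have Lk_lb k : k \in A -> forall z : 'cV[R]_(r k),
      (N n)%:R * frobn z ^+ 2 <= CC * frobn (Lk n k *m z) ^+ 2.
    move=> kA z; apply: (le_trans (scaled_gram_lb Np (gk k kA) z)).
    by rewrite ler_wpM2r ?sqr_ge0.
  (* The last weak exponent is the smallest and [nu <= N], so [c nu] lies below every scale. *)
  have dpos (j : 'I_(q + s'.+1)) : c * nu n <= row_mx (\row_i ds n i) (\row_i dw n i) 0 j.
    rewrite mxE; case: (fintype.split j) => i; rewrite mxE.
      have /andP[h _] := hds n i; apply: le_trans h.
      by rewrite ler_wpM2l ?(ltW c0) // nuN.
    have /andP[h _] := hdw n i; apply: le_trans h.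
    by rewrite ler_wpM2l ?(ltW c0) // ler_powR ?Nge1 // mono // -ltnS ltn_ord.
  have dpos' j : 0 < row_mx (\row_i ds n i) (\row_i dw n i) 0 j :> R.
    by apply: lt_le_trans (dpos j); rewrite mulr_gt0.
  have wl := weighted_gram_lb dpos' g1.
  have c2 (x y : R) : c * x <= 2 * y -> 0 <= y -> x <= CC * y.
    move=> h y0; apply: (@le_trans _ _ (2 / c * y)); last by rewrite ler_wpM2r.
    by rewrite mulrAC ler_pdivlMr // mulrC.
  have L0_lb (z : 'cV[R]_(q + s'.+1)) : nu n * frobn z ^+ 2 <= CC * frobn (L0 n *m z) ^+ 2.
    apply: c2; last exact: sqr_ge0.
    apply: le_trans (wl z); rewrite frobn_sqr mulrA mulr_sumr; apply: ler_sum => j _.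
    by rewrite big_ord1 ler_wpM2r ?sqr_ge0.
  (* Padding [z] by zeros in the weak block leaves only weights of order [N], instead of the scale
     [nu] valid for all of [L0]. *)
  have Ls_lb (z : 'cV[R]_q) : (N n)%:R * frobn z ^+ 2 <= CC * frobn (Ls n *m z) ^+ 2.
    apply: c2; last exact: sqr_ge0.
    have -> : Ls n *m z = L0 n *m col_mx z 0 by rewrite mul_row_col mulmx0 addr0.
    apply: le_trans (wl _); rewrite big_split_ord /= -[X in X <= _]addr0; apply: lerD.
      rewrite frobn_sqr mulrA mulr_sumr; apply: ler_sum => j _.
      rewrite big_ord1 col_mxEu row_mxEl mxE ler_wpM2r ?sqr_ge0 //.
      by have /andP[] := hds n j.
    by apply: sumr_ge0 => j _; rewrite mulr_ge0 ?sqr_ge0 // ltW.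
  have dw0 i : 0 < dw n i.
    have := dpos' (rshift q i); by rewrite row_mxEr mxE.
  have small_rho : 8 * CC ^+ 2 * (rc * u n) ^+ 2 <= 1.
    have C82 : 1 <= 8 * CC ^+ 2 by rewrite mulr_ege1 ?exprn_ege1 // ler1n.
    have ruge : 0 <= rc * u n.
      rewrite mulr_ge0 //.
        rewrite /rc /rho_cst mulr_ge0 ?invr_ge0 ?(ltW kappa0) // mulr_ge0 // addr_ge0 //.
        rewrite /weak_cst addr_ge0 // mulr_ge0 //; first by rewrite mulr_ge0.
        by rewrite addr_ge0 ?addr_ge0 // sumr_ge0 // => k _; rewrite addr_ge0.
      by rewrite /u /weak_rate !addr_ge0 ?divr_ge0 ?mulr_ge0 ?invr_ge0 ?sqrtr_ge0 // ltW.
    exact: mul_sqr_le1 C82 ruge u2.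
  have [H1 H2 H3] := oracle_bound CC1 Nn Tn Tkn qsN rN nup kappa0 good0 goodk L0_ub Lk_ub
    L0_lb Lk_lb small0 smallk (split0 n) (splitk n) (eps0 n) (closek n) (gap n)
    (leadQ0 n w) (fun k kA => leadQk n k w kA) (leadQw n w) Ls_lb dw0 (leadQs n w)
    strong16 u1 small_rho u3.
  have ur : u n <= thm2_rate (N n) (T0 n) (Ttot n) a1 as_ (eps n) by exact: thm2_rate_ge.
  have u0 : 0 <= u n.
    by rewrite /u /weak_rate !addr_ge0 ?divr_ge0 ?mulr_ge0 ?invr_ge0 ?sqrtr_ge0 // ltW.
  have fin (x : R) : x <= `|tc| + `|fc| + 1 ->
      x * u n <= (`|tc| + `|fc| + 1) * thm2_rate (N n) (T0 n) (Ttot n) a1 as_ (eps n).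
    move=> h; apply: (@le_trans _ _ ((`|tc| + `|fc| + 1) * u n)); first by rewrite ler_wpM2r.
    by rewrite ler_wpM2l // !addr_ge0.
  split=> //.
    by apply: (le_trans H2); apply: fin; rewrite -addrA (le_trans (ler_norm _)) // lerDl addr_ge0.
  by apply: (le_trans H3); apply: fin; rewrite addrAC addrC (le_trans (ler_norm _)) // lerDl addr_ge0.
split.
- by move=> n w; case: ifP => //; rewrite unitmx1.
- move=> e /main[C' [C'0 [n0 h]]]; exists C'; split=> //; exists n0 => n /h.
  apply: outer_le_sub => w /= lt [uH le1 _]; move: lt; rewrite uH ltNge => /negP; exact.
move=> e /main[C' [C'0 [n0 h]]]; exists C'; split=> //; exists n0 => n /h.
apply: outer_le_sub => w /= lt [uH _ le1]; move: lt; rewrite uH ltNge => /negP; exact.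
Qed.
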